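(* Let $\widetilde A$ be an arbitrary closed densely defined operator with $A_{\min}\subset\widetilde A\subset A_{\max}$, and let $T:V\to W$ be the corresponding operator. For any $\lambda\in\varrho(\widetilde A)$ there is a bounded operator $M_{\widetilde A}(\lambda):W\to V$, depending holomorphically on $\lambda\in\varrho(\widetilde A)$, such that when $\lambda\in\varrho(A_\beta)$, $-M_{\widetilde A}(\lambda)$ is the inverse of $T+G^\lambda_{V,W}$, and is homeomorphic to the inverse of $T^\lambda$ (that is, $(T^\lambda)^{-1}=-E^\lambda_VM_{\widetilde A}(\lambda)(E'^{\bar\lambda}_W)^*$). It satisfies $$M_{\widetilde A}(\lambda)\bigl((Az^\lambda)_W-T\,\mathrm{pr}_\zeta z^\lambda\bigr)=\mathrm{pr}_\zeta z^\lambda$$ for all $z^\lambda\in Z_\lambda$ such that $\mathrm{pr}_\zeta z^\lambda\in D(T)$. Its definition extends to all $\lambda\in\varrho(\widetilde A)$ by the formula $$M_{\widetilde A}(\lambda)=\mathrm{pr}_\zeta\bigl(I-(\widetilde A-\lambda)^{-1}(A_{\max}-\lambda)\bigr)A_\beta^{-1}\,\mathrm{i}_{W\to H}.$$ In particular, the resolvent formula $$(\widetilde A-\lambda)^{-1}=(A_\beta-\lambda)^{-1}-\mathrm{i}_{V_\lambda\to H}E^\lambda_VM_{\widetilde A}(\lambda)(E'^{\bar\lambda}_W)^*\mathrm{pr}_{W_{\bar\lambda}}$$ holds when $\lambda\in\varrho(\widetilde A)\cap\varrho(A_\beta)$. For all $\lambda\in\varrho(A_\beta)$, $$\ker(\widetilde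 A-\lambda)=E^\lambda_V\ker(T+G^\lambda_{V,W}),\qquad \operatorname{ran}(\widetilde A-\lambda)=(F'^{\bar\lambda}_W)^*\operatorname{ran}(T+G^\lambda_{V,W})+H\ominus W_{\bar\lambda}.$$
   Context: Setting: $H$ is a complex Hilbert space; $A_{\min}$ and $A'_{\min}$ are closed, densely defined operators in $H$ such that $A_{\min}\subset A_{\max}:=(A'_{\min})^*$ and $A'_{\min}\subset A'_{\max}:=(A_{\min})^*$. $A_\beta$ is a closed, densely defined operator with $A_{\min}\subset A_\beta\subset A_{\max}$ and $0\in\varrho(A_\beta)$ ($\varrho$ denotes the resolvent set); then $A'_{\min}\subset A_\beta^*\subset A'_{\max}$. For $u\in D(A_{\max})$, $Au$ means $A_{\max}u$. For a closed subspace $U$, $\mathrm{pr}_U$ is the orthogonal projection onto $U$, $f_U=\mathrm{pr}_Uf$, and $\mathrm{i}_{U\to X}$ the injection of $U$ into $X$. $Z=\ker A_{\max}$, $Z'=\ker A'_{\max}$, $Z_\lambda=\ker(A_{\max}-\lambda)$; $\mathrm{pr}_\zeta=I-A_\beta^{-1}A_{\max}:D(A_{\max})\to Z$, $u_\zeta=\mathrm{pr}_\zeta u$; $\mathrm{pr}_{\zeta'}=I-(A_\beta^* )^{-1}A'_{\max}:D(A'_{\max})\to Z'$. A closed $\widetilde A$ between $A_{\min}$ and $A_{\max}$ corresponds to the closed densely defined operator $T:V\to W$ given by $D(T)=\mathrm{pr}_\zeta D(\widetilde A)$, $V=\overline{D(T)}\subset Z$, $W=\overline{\mathrm{pr}_{\zeta'}D(\widetilde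 A^* )}\subset Z'$, $Tu_\zeta=(Au)_W$ for $u\in D(\widetilde A)$; conversely $D(\widetilde A)=\{u\in D(A_{\max})\mid u_\zeta\in D(T),\ (Au)_W=Tu_\zeta\}$. For $\lambda\in\varrho(A_\beta)$: $\mathrm{pr}^\lambda_\zeta=I-(A_\beta-\lambda)^{-1}(A_{\max}-\lambda)$, $\mathrm{pr}^{\bar\lambda}_{\zeta'}=I-(A_\beta^*-\bar\lambda)^{-1}(A'_{\max}-\bar\lambda)$, and $\widetilde A-\lambda$ corresponds to $T^\lambda:V_\lambda\to W_{\bar\lambda}$ with $D(T^\lambda)=\mathrm{pr}^\lambda_\zeta D(\widetilde A)$, $V_\lambda=\overline{D(T^\lambda)}$, $W_{\bar\lambda}=\overline{\mathrm{pr}^{\bar\lambda}_{\zeta'}D(\widetilde A^* )}$, $T^\lambda\mathrm{pr}^\lambda_\zeta u=((A-\lambda)u)_{W_{\bar\lambda}}$ for $u\in D(\widetilde A)$. $E^\lambda=I+\lambda(A_\beta-\lambda)^{-1}$, $E'^{\bar\lambda}=I+\bar\lambda(A_\beta^*-\bar\lambda)^{-1}$, bounded on $H$, restrict to homeomorphisms $E^\lambda_V:V\to V_\lambda$, $E'^{\bar\lambda}_W:W\to W_{\bar\lambda}$; $F'^{\bar\lambda}_W:W_{\bar\lambda}\to W$ is the inverse of $E'^{\bar\lambda}_W$ (the restriction of $I-\bar\lambda(A^*_\beta)^{-1}$). Adjoints: $(E'^{\bar\lambda}_W)^*:W_{\bar\lambda}\to W$, $(F'^{\bar\lambda}_W)^*:W\to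 W_{\bar\lambda}$. $G^\lambda:Z\to Z'$ is $G^\lambda z=-\lambda\,\mathrm{pr}_{Z'}E^\lambda z$, and $G^\lambda_{V,W}=\mathrm{pr}_WG^\lambda\,\mathrm{i}_{V\to Z}:V\to W$. *)

(* Defs.v *)
From mathcomp Require Import all_boot all_order all_algebra.
From mathcomp Require Import complex.
From mathcomp Require Import boolp classical_sets reals topology normedtype.

Set Implicit Arguments.
Unset Strict Implicit.
Unset Printing Implicit Defensive.

Import Order.TTheory GRing.Theory Num.Theory.
Import numFieldNormedType.Exports.

Local Open Scope classical_set_scope.
Local Open Scope ring_scope.

(* An unbounded operator in H is represented by its graph, a set of pairs
   (u, A u).  Thus inclusion of operators is inclusion of graphs, and an
   operator from a subspace V to a subspace W is a graph contained in V x W. *)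
Section Operators.
Context {K : numFieldType} {H : normedModType K}.
Implicit Types (A : set (H * H)) (U V W : set H) (l : K).

Definition dom A : set H := [set u | exists f, A (u, f)].
Definition ran A : set H := [set f | exists u, A (u, f)].
Definition ker A : set H := [set u | A (u, 0)].

(* The value A u for u in D(A), a junk value outside D(A). *)
Definition app A (u : H) : H := xget 0 [set f | A (u, f)].

Definition linear_operator A : Prop :=
  [/\ A (0, 0),
      forall (a : K) p q, A p -> A q -> A (a *: p + q) &
      forall u f g, A (u, f) -> A (u, g) -> f = g].

Definition closed_densely_defined A : Prop :=
  [/\ linear_operator A, closed A & dense (dom A)].

Definition op_inv A : set (H * H) := [set p | A (p.2, p.1)].

(* A - l *)
Definition op_shift A l : set (H * H) := [set p | A (p.1, p.2 + l *: p.1)].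

(* A + S, for S an everywhere defined map *)
Definition op_add A (S : H -> H) : set (H * H) :=
  [set p | A (p.1, p.2 - S p.1)].

(* The operator with domain U acting as S *)
Definition op_on U (S : H -> H) : set (H * H) :=
  [set p | U p.1 /\ p.2 = S p.1].

Definition resolvent_set A : set K :=
  [set l | [/\ ker (op_shift A l) = [set 0],
               ran (op_shift A l) = setT &
               exists c : K, forall u f,
                 op_shift A l (u, f) -> `|u| <= c * `|f|]].

(* (A - l)^-1, everywhere defined when l is in the resolvent set *)
Definition resolvent A l (f : H) : H := app (op_inv (op_shift A l)) f.

(* S restricts to a bounded linear operator U -> V. *)
Definition bounded_operator U V (S : H -> H) : Prop :=
  [/\ forall u, U u -> V (S u),
      forall (a : K) u v, U u -> U v -> S (a *: u + v) = a *: S u + S v &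
      exists c : K, forall u, U u -> `|S u| <= c * `|u|].

(* Holomorphy in operator norm on an open set O of a family of bounded
   operators U -> V: the difference quotients converge in operator norm to a
   bounded operator U -> V. *)
Definition holomorphic_family (O : set K) U V (M : K -> H -> H) : Prop :=
  open O /\
  forall l0, O l0 -> exists2 D : H -> H, bounded_operator U V D &
    forall eps : K, 0 < eps -> \forall l \near l0^', forall u, U u ->
      `| (l - l0)^-1 *: (M l u - M l0 u) - D u | <= eps * `|u|.

(* The abstract projection I - B^-1 A : D(A) -> ker A *)
Definition pr_along B A (u : H) : H := u - app (op_inv B) (app A u).

End Operators.

Section Hilbert.
Context {R : realType} {H : completeNormedModType R[i]}.
Variable dot : {dot H for Num.conj}.
Implicit Types (A : set (H * H)) (U : set H).

(* The graph of the Hilbert space adjoint of a densely defined A; dot is linear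
   in its first argument and conjugate linear in the second. *)
Definition adjoint A : set (H * H) :=
  [set p | forall u f, A (u, f) -> dot f p.1 = dot u p.2].

Definition orthocomp U : set H := [set h | forall u, U u -> dot h u = 0].

(* The orthogonal projection onto a closed subspace U *)
Definition pr U (f : H) : H :=
  xget 0 [set u | U u /\ orthocomp U (f - u)].

(* The adjoint of a bounded operator S defined on the closed subspace U *)
Definition adjoint_on U (S : H -> H) (y : H) : H :=
  xget 0 [set x | U x /\ forall u, U u -> dot (S u) y = dot u x].

(* The operator with domain p D(At) given by  p u |-> pr_W (A u), u in D(At) *)
Definition corresp_op (p : H -> H) A At W : set (H * H) :=
  [set (p u, pr W (app A u)) | u in dom At].

End Hilbert.

(* Main.v *)
From mathcomp Require Import all_boot all_order all_algebra.
From mathcomp Require Import complex.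
From mathcomp Require Import boolp classical_sets reals prodnormedzmodule.
From mathcomp Require Import topology normedtype.
From mathcomp Require Import ring.
Require Import Defs.
Set Implicit Arguments.
Unset Strict Implicit.
Unset Printing Implicit Defensive.
Import Order.TTheory GRing.Theory Num.Theory.
Import numFieldNormedType.Exports.
Local Open Scope classical_set_scope.
Local Open Scope ring_scope.

(* Put S = A_beta^-1, F = I - lambda S, R = (At - lambda)^-1, and
   M(lambda) = S F - F R F, which is visibly bounded and holomorphic in lambda;
   it equals - pr_zeta R F. Two facts drive the proof. First, since At is the
   adjoint of its adjoint, every h orthogonal to W satisfies S h in D(At) with
   At (S h) = h; hence M(lambda) kills the complement of W. Secondly,
   (A u)_W + pr_W G^lambda u_zeta = pr_W E^lambda (A - lambda) u for u in D(At),
   where E^lambda and F are mutually inverse, so T + G^lambda_{V,W} has the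
   graph { (u_zeta, pr_W E^lambda (A - lambda) u) }. The adjoint of E'^lambda_W
   is pr_W E^lambda, that of F'^lambda_W is pr_{W_lambda} F, and E^lambda, F
   exchange the complements of W_lambda and W. Biadjoints and adjoints of
   resolvents come from the projection theorem in H x H. *)

(** The obstacle is that [E] and [G] make sense only for [l] in the resolvent set of [Ab], while [M]
    must live on the whole resolvent set of [At]. Formally [E] is [Ab (Ab - l)^-1] and [F] is
    [(Ab - l) Ab^-1]; of the two only [F] is polynomial in [l], whence a formula for [M] built from
    [S], [F] and the resolvent of [At] alone. Where [E] exists, [M (E g) = - pr_zeta (R g)]; read
    with [u = R g], this single identity yields the inverse of [T + G], the inverse of [T^lambda]
    and the resolvent formula. The biadjoint needs orthogonality in H x H, whose norm here is the
    maximum of the coordinate norms and not a Hilbert norm. The projection theorem is therefore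
    proved for the form [pair_dot], and the projections in H are deduced from it. *)

Notation bounded_op := (bounded_operator setT setT).

(** * Bounded operators on a normed space *)

Section Norms.
Context {K : numFieldType} {H : normedModType K}.
Implicit Types (U V : set H) (S : H -> H).

Lemma closure_distP (T : normedModType K) (A : set T) x :
  closure A x <-> forall e : K, 0 < e -> exists2 y, A y & `|x - y| < e.
Proof.
split=> [clA e e0|clA B /nbhs_ballP[e /= e0 eB]].
  have [y [Ay]] := clA _ (nbhsx_ballx x e e0).
  by rewrite -ball_normE => xy; exists y.
by have [y Ay xy] := clA _ e0; exists y; split=> //; apply: eB; rewrite -ball_normE.
Qed.

Lemma closed_dist (T : normedModType K) (A : set T) x : closed A ->
  (forall e : K, 0 < e -> exists2 y, A y & `|x - y| < e) -> A x.
Proof. by move=> clA /closure_distP; exact: clA. Qed.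

Lemma norm_pair_le (p : (H * H)%type) : `|p.1| <= `|p| /\ `|p.2| <= `|p|.
Proof.
rewrite prodnormedzmodule.ProdNormedZmodule.prod_normE.
have cmp : `|p.1| >=< `|p.2| by apply: real_comparable; exact: normr_real.
by rewrite !comparable_le_max// !lexx orbT.
Qed.

Lemma norm_pair_lt (p : (H * H)%type) (e : K) :
  `|p.1| < e -> `|p.2| < e -> `|p| < e.
Proof.
by rewrite prodnormedzmodule.ProdNormedZmodule.prod_normE /Num.max; case: ifP.
Qed.

Lemma near_dnbhs (l0 d : K) (P : K -> Prop) : 0 < d ->
  (forall l, l != l0 -> `|l - l0| < d -> P l) -> \forall l \near l0^', P l.
Proof.
move=> d0 dP; apply/nbhs_ballP; exists d => // l; rewrite -ball_normE /= distrC.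
by move=> ld ll0; exact: dP.
Qed.

Definition subspace U :=
  U 0 /\ forall (a : K) u v, U u -> U v -> U (a *: u + v).

Lemma subspaceD U u v : subspace U -> U u -> U v -> U (u + v).
Proof. by move=> [_ UP] Uu Uv; rewrite -[u]scale1r; exact: UP. Qed.

Lemma subspaceZ U a u : subspace U -> U u -> U (a *: u).
Proof. by move=> [U0 UP] Uu; rewrite -[_ *: _]addr0; exact: UP. Qed.

Lemma subspaceN U u : subspace U -> U u -> U (- u).
Proof. by move=> sU Uu; rewrite -scaleN1r; exact: subspaceZ. Qed.

Lemma subspaceB U u v : subspace U -> U u -> U v -> U (u - v).
Proof. by move=> sU Uu Uv; apply: subspaceD => //; exact: subspaceN. Qed.

Lemma closure_subspace U : subspace U -> subspace (closure U).
Proof.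
move=> [U0 UP]; split; first exact: subset_closure.
move=> a u v /closure_distP clu /closure_distP clv; apply/closure_distP => e e0.
have e20 : 0 < e / 2 by rewrite divr_gt0.
have a0 : 0 < `|a| + 1 by rewrite ltr_wpDl.
have [u' Uu' uu'] := clu (e / 2 / (`|a| + 1)) (divr_gt0 e20 a0).
have [v' Uv' vv'] := clv _ e20.
exists (a *: u' + v'); first exact: UP.
rewrite opprD addrACA -scalerBr (le_lt_trans (ler_normD _ _))// [e]splitr.
rewrite ler_ltD// normrZ.
rewrite (le_trans (ler_wpM2l (normr_ge0 a) (ltW uu')))//.
rewrite mulrCA ler_piMr ?(ltW e20)//.
by rewrite ler_pdivrMr// mul1r lerDl.
Qed.

Lemma bounded_opD S u v : bounded_op S -> S (u + v) = S u + S v.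
Proof. by case=> _ lS _; have := lS 1 u v I I; rewrite !scale1r. Qed.

Lemma bounded_op0 S : bounded_op S -> S 0 = 0.
Proof. by move=> bS; apply: (addrI (S 0)); rewrite -bounded_opD// !addr0. Qed.

Lemma bounded_opZ S a u : bounded_op S -> S (a *: u) = a *: S u.
Proof.
move=> bS; case: (bS) => _ lS _; have := lS a u 0 I I.
by rewrite (bounded_op0 bS) !addr0.
Qed.

Lemma bounded_opN S u : bounded_op S -> S (- u) = - S u.
Proof. by move=> bS; rewrite -scaleN1r bounded_opZ// scaleN1r. Qed.

Lemma bounded_opB S u v : bounded_op S -> S (u - v) = S u - S v.
Proof. by move=> bS; rewrite bounded_opD// bounded_opN. Qed.

Lemma bounded_op_bound S : bounded_op S ->
  exists2 c : K, 0 < c & forall u, `|S u| <= c * `|u|.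
Proof.
(* The given [c] may be negative when [H] is trivial; [+ 1] makes the constant strictly positive. *)
case=> _ _ [c bc]; exists (`|c| + 1) => [|u]; first by rewrite ltr_wpDl.
have := bc u I; have [->|u0] := eqVneq u 0.
  by rewrite normr0 !mulr0.
have nu : 0 < `|u| by rewrite normr_gt0.
move=> h; have c0 : 0 <= c.
  by rewrite -(pmulr_lge0 _ nu); exact: le_trans h.
by rewrite ger0_norm// (le_trans h)// ler_wpM2r// lerDl.
Qed.

Lemma bounded_opI S : (forall a u v, S (a *: u + v) = a *: S u + S v) ->
  (exists c : K, forall u, `|S u| <= c * `|u|) -> bounded_op S.
Proof. by move=> lS [c bc]; split=> //; exists c => u _; exact: bc. Qed.

Lemma bounded_op_id : bounded_op (@id H).
Proof. by apply: bounded_opI => //; exists 1 => u; rewrite mul1r. Qed.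

Lemma bounded_op_comp S1 S2 :
  bounded_op S1 -> bounded_op S2 -> bounded_op (fun u => S1 (S2 u)).
Proof.
move=> b1 b2; apply: bounded_opI => [a u v|].
  rewrite (bounded_opD _ _ b2) (bounded_opZ _ _ b2).
  by rewrite (bounded_opD _ _ b1) (bounded_opZ _ _ b1).
have [c1 c10 h1] := bounded_op_bound b1; have [c2 c20 h2] := bounded_op_bound b2.
exists (c1 * c2) => u; rewrite (le_trans (h1 _))// -mulrA ler_wpM2l//; exact: ltW.
Qed.

Lemma bounded_op_add S1 S2 :
  bounded_op S1 -> bounded_op S2 -> bounded_op (fun u => S1 u + S2 u).
Proof.
move=> b1 b2; apply: bounded_opI => [a u v|].
  rewrite (bounded_opD _ _ b1) (bounded_opD _ _ b2) (bounded_opZ _ _ b1).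
  by rewrite (bounded_opZ _ _ b2) scalerDr addrACA.
have [c1 c10 h1] := bounded_op_bound b1; have [c2 c20 h2] := bounded_op_bound b2.
by exists (c1 + c2) => u; rewrite (le_trans (ler_normD _ _))// mulrDl lerD.
Qed.

Lemma bounded_op_scale a S : bounded_op S -> bounded_op (fun u => a *: S u).
Proof.
move=> b1; apply: bounded_opI => [c u v|].
  by rewrite (bounded_opD _ _ b1) (bounded_opZ _ _ b1) scalerDr !scalerA mulrC.
have [c1 c10 h1] := bounded_op_bound b1.
by exists (`|a| * c1) => u; rewrite normrZ -mulrA ler_wpM2l.
Qed.

Lemma bounded_op_sub S1 S2 :
  bounded_op S1 -> bounded_op S2 -> bounded_op (fun u => S1 u - S2 u).
Proof.
move=> b1 b2; have := bounded_op_add b1 (bounded_op_scale (-1) b2).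
by congr (bounded_op _); apply/funext => u; rewrite scaleN1r.
Qed.

Lemma bounded_op_closure S U V u : bounded_op S ->
  (forall u, U u -> closure V (S u)) -> closure U u -> closure V (S u).
Proof.
move=> bS UV /closure_distP clu; apply: closed_closure.
apply/closure_distP => e e0; have [c c0 bc] := bounded_op_bound bS.
have [v Uv uv] := clu _ (divr_gt0 e0 c0); exists (S v); first exact: UV.
by rewrite -bounded_opB// (le_lt_trans (bc _))// mulrC -ltr_pdivlMr.
Qed.

End Norms.

(** * The projection theorem in H x H *)

Section Projection.
Context {R : realType} {H : completeNormedModType R[i]}.
Variable dot : {dot H for Num.conj}.
Hypothesis dot_norm : forall x : H, dot x x = `|x| ^+ 2.
Implicit Types (u v x y : H) (p e : (H * H)%type) (C : set (H * H)).

Lemma dotDl u v x : dot (u + v) x = dot u x + dot v x.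
Proof. exact: linearDl. Qed.
Lemma dotDr x u v : dot x (u + v) = dot x u + dot x v.
Proof. exact: linearDr. Qed.
Lemma dotZl (a : R[i]) u x : dot (a *: u) x = a * dot u x.
Proof. exact: linearZl_LR. Qed.
Lemma dotZr (a : R[i]) x u : dot x (a *: u) = a^* * dot x u.
Proof. exact: linearZr_LR. Qed.
Lemma dotC u v : dot u v = (dot v u)^*.
Proof. by rewrite hermC /= expr0 mul1r. Qed.
Lemma dotNl u x : dot (- u) x = - dot u x.
Proof. by rewrite -scaleN1r dotZl mulN1r. Qed.
Lemma dotNr x u : dot x (- u) = - dot x u.
Proof. by rewrite dotC dotNl rmorphN /= -dotC. Qed.
Lemma dotBl u v x : dot (u - v) x = dot u x - dot v x.
Proof. by rewrite dotDl dotNl. Qed.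
Lemma dotBr x u v : dot x (u - v) = dot x u - dot x v.
Proof. by rewrite dotDr dotNr. Qed.
Lemma dot0l x : dot 0 x = 0.
Proof. by rewrite -(scale0r 0) dotZl mul0r. Qed.
Lemma dot0r x : dot x 0 = 0.
Proof. by rewrite dotC dot0l rmorph0. Qed.

Lemma dotxx_eq0 x : dot x x = 0 -> x = 0.
Proof. by rewrite dot_norm => /eqP; rewrite expf_eq0 /= normr_eq0 => /eqP. Qed.

Definition pair_dot p e : R[i] := dot p.1 e.1 + dot p.2 e.2.

Lemma pair_dotDl p q e : pair_dot (p + q) e = pair_dot p e + pair_dot q e.
Proof. by rewrite /pair_dot !dotDl addrACA. Qed.
Lemma pair_dotZl (a : R[i]) p e : pair_dot (a *: p) e = a * pair_dot p e.
Proof. by rewrite /pair_dot !dotZl mulrDr. Qed.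
Lemma pair_dotC p e : pair_dot p e = (pair_dot e p)^*.
Proof. by rewrite /pair_dot rmorphD /= -!dotC. Qed.
Lemma pair_dotBl p q e : pair_dot (p - q) e = pair_dot p e - pair_dot q e.
Proof. by rewrite pair_dotDl -scaleN1r pair_dotZl mulN1r. Qed.

Lemma pair_dot_norm p : pair_dot p p = `|p.1| ^+ 2 + `|p.2| ^+ 2.
Proof. by rewrite /pair_dot !dot_norm. Qed.
Lemma pair_dot_ge0 p : 0 <= pair_dot p p.
Proof. by rewrite pair_dot_norm addr_ge0// exprn_ge0. Qed.

(* Cauchy-Schwarz is the case [d = 0]; for [d] the squared distance from [p] to
   a subspace containing [e], nearly minimising [p] are nearly orthogonal. *)
Lemma pair_dot_variation p e (d : R[i]) :
  (forall t : R[i], d <= pair_dot (p - t *: e) (p - t *: e)) ->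
  `|pair_dot p e| ^+ 2 <= (pair_dot p p - d) * pair_dot e e.
Proof.
move=> dP; have := pair_dot_ge0 e; rewrite le_eqVlt => /orP[/eqP e0|e0].
  have [e1 e2] : e.1 = 0 /\ e.2 = 0.
    have := e0; rewrite pair_dot_norm => /esym/eqP.
    rewrite paddr_eq0 ?exprn_ge0// !expf_eq0 /= !normr_eq0.
    by move=> /andP[/eqP -> /eqP ->].
  by rewrite -e0 mulr0 /pair_dot e1 e2 !dot0r addr0 normr0 expr0n.
rewrite -ler_pdivrMr// lerBrDl -lerBrDr.
(* This coefficient makes [p - t *: e] orthogonal to [e], so it minimises the left-over norm. *)
apply: le_trans (dP (pair_dot p e / pair_dot e e)) _.
set t := _ / _.
have ecj : (pair_dot e e)^* = pair_dot e e by rewrite -pair_dotC.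
have -> : pair_dot (p - t *: e) (p - t *: e) = pair_dot p p
    - t * pair_dot e p - (t^* * pair_dot p e - t^* * t * pair_dot e e).
  rewrite pair_dotBl pair_dotZl (pair_dotC p (_ - _)) (pair_dotC e (_ - _)).
  rewrite !pair_dotBl !pair_dotZl !rmorphB !rmorphM /= -!pair_dotC.
  ring.
have -> : t^* * t * pair_dot e e = t^* * pair_dot p e.
  by rewrite -mulrA divfK// gt_eqF.
rewrite subrr subr0 lerD2l lerN2 /t normCK (pair_dotC e p).
by rewrite mulrAC.
Qed.

Lemma pair_CauchySchwarz p e :
  `|pair_dot p e| ^+ 2 <= pair_dot p p * pair_dot e e.
Proof.
have := @pair_dot_variation p e 0 (fun t => pair_dot_ge0 _).
by rewrite subr0.
Qed.

Lemma CauchySchwarz_norm x y : `|dot x y| <= `|x| * `|y|.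
Proof.
rewrite -(@ler_pXn2r _ 2%N)// ?nnegrE ?mulr_ge0// exprMn.
have := pair_CauchySchwarz (x, 0) (y, 0).
by rewrite !pair_dot_norm /pair_dot /= dot0l normr0 expr0n !addr0.
Qed.

(** The order of [R[i]] compares only numbers with equal imaginary part, so a positive tolerance is
    a real one. *)
Lemma posc_real (e : R[i]) : 0 < e -> exists2 r : R, 0 < r & e = r%:C%C.
Proof.
case: e => a b /=; rewrite ltcE /= => /andP[/eqP -> a0].
by exists a.
Qed.

Lemma archi_inv (e : R[i]) : 0 < e -> exists n : nat, n.+1%:R^-1 < e.
Proof.
move=> /posc_real[r r0 ->]; exists (Num.bound r^-1).
have -> : (Num.bound r^-1).+1%:R^-1 = ((Num.bound r^-1).+1%:R^-1 : R)%:C%C.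
  by rewrite fmorphV rmorph_nat.
rewrite ltcR invf_plt ?posrE ?ltr0n//.
apply: lt_le_trans (archi_boundP _) _; first by rewrite invr_ge0 ltW.
by rewrite ler_nat.
Qed.

Lemma seq_complete (u : nat -> H) :
  (forall e : R[i], 0 < e ->
     exists N, forall m n, (N <= m)%N -> (N <= n)%N -> `|u m - u n| < e) ->
  exists l, forall e : R[i], 0 < e ->
    exists N, forall n, (N <= n)%N -> `|l - u n| < e.
Proof.
move=> uc; have : cauchy (u n @[n --> \oo]).
  apply/cauchy_ballP => e /uc[N hN].
  rewrite near_map2; exists ([set n | (N <= n)%N], [set n | (N <= n)%N]) => /=.
    by split; exists N.
  by move=> [m n] [/= Nm Nn]; rewrite -ball_normE; exact: hN.
move=> /cauchy_cvgP/cvg_ex[l /cvgrPdist_lt ul]; exists l => e /ul[N _ hN].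
by exists N.
Qed.

(** [c n] is chosen with squared distance to [p] within [n.+1%:R^-1 ^+ 2] of the infimum, and
    [pair_dot_variation] turns this excess into near orthogonality. The infimum is that of the real
    part [q], since it has to be taken in [R]. *)
Lemma minimizing_sequence C p : subspace C ->
  exists c : nat -> H * H, forall n, C (c n) /\ forall e, C e ->
    `|pair_dot (p - c n) e| ^+ 2 <= n.+1%:R^-1 ^+ 2 * pair_dot e e.
Proof.
move=> [C0 CP]; pose q c := complex.Re (pair_dot (p - c) (p - c)).
have qE c : (q c)%:C%C = pair_dot (p - c) (p - c).
  have := pair_dot_ge0 (p - c); rewrite /q; case: (pair_dot _ _) => a b.
  by rewrite lecE /= => /andP[/eqP ->].
have q0 c : 0 <= q c by rewrite -ler0c qE pair_dot_ge0.
have lbq : has_lbound (q @` C) by exists 0 => _ [c _ <-].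
have iq : has_inf (q @` C) by split=> //; exists (q 0), 0.
suff : forall n, exists c, C c /\ forall e, C e ->
    `|pair_dot (p - c) e| ^+ 2 <= n.+1%:R^-1 ^+ 2 * pair_dot e e.
  by move=> /choice[c cP]; exists c.
move=> n; have e0 : 0 < (n.+1%:R^-1 : R) ^+ 2 by rewrite exprn_gt0// invr_gt0.
have [_ [c Cc <-] cP] := inf_adherent e0 iq; exists c; split=> // e Ce.
apply: (@le_trans _ _
    ((pair_dot (p - c) (p - c) - (inf (q @` C))%:C%C) * pair_dot e e)).
  apply: pair_dot_variation => t.
  rewrite -addrA -opprD -qE lecR; apply: ge_inf => //; exists (c + t *: e) => //.
  by rewrite addrC; exact: CP.
apply: ler_wpM2r; first exact: pair_dot_ge0.
rewrite -qE -rmorphB /=.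
have -> : n.+1%:R^-1 ^+ 2 = ((n.+1%:R^-1 : R) ^+ 2)%:C%C.
  by rewrite rmorphXn fmorphV rmorph_nat.
by rewrite lecR lerBlDl; exact: ltW.
Qed.

(** The near minimisers form a Cauchy sequence because their difference is itself an admissible test
    vector for near orthogonality. The two coordinates then converge separately in [H], and
    orthogonality passes to the limit. *)
Theorem pair_projection C p : closed C -> subspace C ->
  exists2 c, C c & forall e, C e -> pair_dot (p - c) e = 0.
Proof.
move=> clC sC; have [c cP] := minimizing_sequence p sC.
have le_inv m n : (m <= n)%N -> n.+1%:R^-1 <= m.+1%:R^-1 :> R[i].
  by move=> mn; rewrite lef_pV2 ?posrE ?ltr0n// ler_nat ltnS.
have diff2 N m n : (N <= m)%N -> (N <= n)%N ->
    pair_dot (c m - c n) (c m - c n) <= (2 * N.+1%:R^-1) ^+ 2.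
  move=> Nm Nn; set e := c m - c n.
  have Ce : C e by apply: subspaceB => //; [exact: (cP m).1|exact: (cP n).1].
  have near k : (N <= k)%N ->
      `|pair_dot (p - c k) e| ^+ 2 <= N.+1%:R^-1 ^+ 2 * pair_dot e e.
    move=> Nk; apply: le_trans ((cP k).2 e Ce) _.
    apply: ler_wpM2r; first exact: pair_dot_ge0.
    by rewrite lerXn2r ?nnegrE ?invr_ge0 ?ler0n// le_inv.
  have [e0|] := eqVneq (pair_dot e e) 0.
    by rewrite e0 exprn_ge0// mulr_ge0// invr_ge0.
  move=> ne0; have e0 : 0 < pair_dot e e by rewrite lt_def ne0 pair_dot_ge0.
  (* With [e = c m - c n] as test vector, its square norm is a difference of two nearly vanishing
     products, each at most [N.+1%:R^-1] times the norm of [e]. *)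
  have eE : pair_dot e e = pair_dot (p - c n) e - pair_dot (p - c m) e.
    by rewrite -pair_dotBl opprB [(p - _) + _]addrC addrA subrK.
  set a := pair_dot (p - c n) e; set b := pair_dot (p - c m) e.
  have ab : `|a - b| ^+ 2 <= 2 * (`|a| ^+ 2 + `|b| ^+ 2).
    apply: le_trans (_ : (`|a| + `|b|) ^+ 2 <= _).
      by rewrite lerXn2r ?nnegrE ?addr_ge0// ler_normB.
    rewrite -subr_ge0.
    have -> : 2 * (`|a| ^+ 2 + `|b| ^+ 2) - (`|a| + `|b|) ^+ 2
      = (`|a| - `|b|) ^+ 2 by ring.
    by rewrite -realEsqr rpredB// normr_real.
  rewrite -(ler_pM2r e0) -expr2 -[X in X ^+ 2 <= _]ger0_norm; last exact: ltW.
  rewrite [X in `|X|]eE; apply: le_trans ab _.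
  apply: le_trans (_ : 2 * (N.+1%:R^-1 ^+ 2 * pair_dot e e
      + N.+1%:R^-1 ^+ 2 * pair_dot e e) <= _).
    by rewrite ler_pM2l// lerD// near.
  by rewrite le_eqVlt; apply/orP; left; apply/eqP; ring.
have bound (x : H) N : `|x| ^+ 2 <= (2 * N.+1%:R^-1) ^+ 2 -> `|x| <= 2 * N.+1%:R^-1.
  by rewrite ler_pXn2r// nnegrE ?mulr_ge0 ?invr_ge0.
have diff (f : H * H -> H) :
    (forall q, `|f q| ^+ 2 <= pair_dot q q) -> (forall q r, f (q - r) = f q - f r) ->
    forall e : R[i], 0 < e -> exists N, forall m n, (N <= m)%N -> (N <= n)%N ->
    `|f (c m) - f (c n)| < e.
  move=> fb fB e e0; have [N NP] := archi_inv (divr_gt0 e0 (ltr0Sn _ 1)).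
  exists N => m n Nm Nn; rewrite -fB.
  apply: le_lt_trans (_ : 2 * N.+1%:R^-1 < _); last by rewrite mulrC -ltr_pdivlMr.
  by apply: bound; apply: le_trans (fb _) _; exact: diff2.
have [l1 l1P] : exists l, forall e : R[i], 0 < e ->
    exists N, forall n, (N <= n)%N -> `|l - (c n).1| < e.
  apply: seq_complete; apply: (diff fst) => // q.
  by rewrite pair_dot_norm lerDl exprn_ge0.
have [l2 l2P] : exists l, forall e : R[i], 0 < e ->
    exists N, forall n, (N <= n)%N -> `|l - (c n).2| < e.
  apply: seq_complete; apply: (diff snd) => // q.
  by rewrite pair_dot_norm lerDr exprn_ge0.
have lim (d : R[i]) : 0 < d -> exists2 n, n.+1%:R^-1 < d &
    `|l1 - (c n).1| < d /\ `|l2 - (c n).2| < d.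
  move=> d0; have [N NP] := archi_inv d0.
  have [N1 N1P] := l1P _ d0; have [N2 N2P] := l2P _ d0.
  exists (maxn N (maxn N1 N2)).
    by apply: le_lt_trans NP; apply: le_inv; rewrite leq_maxl.
  by split; [apply: N1P|apply: N2P]; rewrite !leq_max leqnn ?orbT.
exists (l1, l2) => [|e Ce].
  apply: closed_dist => // e /lim[n _ [n1 n2]]; exists (c n); first exact: (cP n).1.
  exact: norm_pair_lt.
apply/eqP; rewrite -normr_le0; apply/ler_addgt0Pl => eps eps0; rewrite addr0.
(* [k] dominates both the Hilbert norm of [e] and the sum of its coordinate norms. Half of [eps]
   pays for the near orthogonality of [p - c n], half for replacing [c n] by the limit. *)
pose k := `|e.1| + `|e.2| + 1; have k0 : 0 < k by rewrite ltr_wpDl// addr_ge0.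
have k20 : 0 < 2 * k by rewrite mulr_gt0.
have [n nP [n1 n2]] := lim _ (divr_gt0 eps0 k20).
have -> : p - (l1, l2) = (p - c n) - ((l1, l2) - c n).
  by rewrite opprB addrA subrK.
rewrite pair_dotBl (le_trans (ler_normB _ _))//.
have -> : eps = eps / (2 * k) * k + eps / (2 * k) * k.
  by field; rewrite gt_eqF.
apply: lerD.
  apply: le_trans (ler_wpM2r (ltW k0) (ltW nP)).
  rewrite -(@ler_pXn2r _ 2%N)// ?nnegrE ?mulr_ge0 ?invr_ge0 ?(ltW k0)// exprMn.
  apply: le_trans ((cP n).2 _ Ce) _; apply: ler_wpM2l.
    by rewrite exprn_ge0// invr_ge0.
  rewrite pair_dot_norm -subr_ge0.
  have -> : k ^+ 2 - (`|e.1| ^+ 2 + `|e.2| ^+ 2) =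
    2 * (`|e.1| * `|e.2|) + 2 * `|e.1| + 2 * `|e.2| + 1 by rewrite /k; ring.
  by rewrite !addr_ge0// !mulr_ge0.
rewrite /pair_dot (le_trans (ler_normD _ _))//.
apply: le_trans (_ : eps / (2 * k) * `|e.1| + eps / (2 * k) * `|e.2| <= _).
  apply: lerD; apply: le_trans (CauchySchwarz_norm _ _) _.
    by rewrite ler_wpM2r// ltW.
  by rewrite ler_wpM2r// ltW.
rewrite -mulrDr ler_pM2l ?divr_gt0//.
by rewrite /k lerDl.
Qed.

End Projection.

(** * Resolvents and adjoints of unbounded operators *)

Section Resolvent.
Context {K : numFieldType} {H : normedModType K}.
Implicit Types (A : set (H * H)) (u f g : H).

Lemma linear_operatorD A u f v g :
  linear_operator A -> A (u, f) -> A (v, g) -> A (u + v, f + g).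
Proof. by move=> [_ lA _] Au Av; have := lA 1 _ _ Au Av; rewrite !scale1r. Qed.

Lemma linear_operatorZ A (a : K) u f :
  linear_operator A -> A (u, f) -> A (a *: u, a *: f).
Proof. by move=> [A0 lA _] Au; have := lA a _ _ Au A0; rewrite !addr0. Qed.

Lemma linear_operatorB A u f v g :
  linear_operator A -> A (u, f) -> A (v, g) -> A (u - v, f - g).
Proof.
move=> lA Au Av; rewrite -(scaleN1r v) -(scaleN1r g).
by apply: linear_operatorD => //; exact: linear_operatorZ.
Qed.

Lemma appE A u f : linear_operator A -> A (u, f) -> app A u = f.
Proof. by move=> [_ _ fA] Auf; apply: xget_unique => // g /fA; exact. Qed.

Lemma op_shift_linear A l : linear_operator A -> linear_operator (op_shift A l).
Proof.
move=> lA; split=> /=.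
- by rewrite /op_shift /= scaler0 addr0; case: lA.
- move=> a [u f] [v g]; rewrite /op_shift /= => Au Av.
  rewrite scalerDr scalerA mulrC -scalerA addrACA -scalerDr.
  by apply: linear_operatorD => //; exact: linear_operatorZ.
- by move=> u f g; case: lA => _ _ fA; rewrite /op_shift /= => /fA h /h /addIr.
Qed.

Lemma subspace_dom A : linear_operator A -> subspace (dom A).
Proof.
move=> lA; split; first by exists 0; case: lA.
move=> a u v [f Af] [g Ag]; exists (a *: f + g).
by apply: linear_operatorD => //; exact: linear_operatorZ.
Qed.

Lemma app_op_shift A l u : linear_operator A -> dom A u ->
  app (op_shift A l) u = app A u - l *: u.
Proof.
move=> lA [f Af]; rewrite (appE lA Af); apply: appE; first exact: op_shift_linear.
by rewrite /op_shift /= subrK.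
Qed.

Lemma resolvent_eq A l u f : linear_operator A -> resolvent_set A l ->
  A (u, f + l *: u) -> resolvent A l f = u.
Proof.
move=> lA [kA _ _] Au; apply: xget_unique => // v.
rewrite /op_inv /op_shift /= => Av.
have : ker (op_shift A l) (v - u).
  have := linear_operatorB lA Av Au.
  by rewrite /ker /op_shift /= add0r scalerBr opprD addrACA subrr add0r.
by rewrite kA => /subr0_eq.
Qed.

Lemma resolventP A l f : resolvent_set A l ->
  A (resolvent A l f, f + l *: resolvent A l f).
Proof.
move=> [_ rA _]; have : ran (op_shift A l) f by rewrite rA.
by move=> ex; have := @xgetPex _ 0 _ ex.
Qed.

Lemma resolvent_bounded A l : linear_operator A -> resolvent_set A l ->
  bounded_op (resolvent A l).
Proof.
move=> lA rl; apply: bounded_opI => [a u v|]; last first.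
  by case: (rl) => _ _ [c cP]; exists c => f; apply: cP; exact: resolventP.
apply: resolvent_eq => //.
rewrite scalerDr scalerA mulrC -scalerA addrACA -scalerDr.
apply: linear_operatorD => //; last exact: resolventP.
by apply: linear_operatorZ => //; exact: resolventP.
Qed.

Lemma resolvent_identity A l m f : linear_operator A ->
  resolvent_set A l -> resolvent_set A m ->
  resolvent A l f - resolvent A m f = (l - m) *: resolvent A l (resolvent A m f).
Proof.
move=> lA rl rm; set v := resolvent A m f.
have : resolvent A l (f - (l - m) *: v) = v.
  apply: resolvent_eq => //.
  by rewrite scalerBl opprB -addrA subrK; exact: resolventP.
have bl := resolvent_bounded lA rl.
rewrite (bounded_opB _ _ bl) (bounded_opZ _ _ bl) => {1}<-.
by rewrite opprB addrC subrK.
Qed.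

End Resolvent.

(** * Projections, Riesz representation, biadjoints and openness of the resolvent set *)

Section Hilbert.
Context {R : realType} {H : completeNormedModType R[i]}.
Variable dot : {dot H for Num.conj}.
Hypothesis dot_norm : forall x : H, dot x x = `|x| ^+ 2.
Implicit Types (A : set (H * H)) (U : set H) (u f g h x y : H).

Lemma orthocomp_sub U x y :
  orthocomp dot U x -> orthocomp dot U y -> orthocomp dot U (x - y).
Proof. by move=> Ux Uy u Uu; rewrite dotBl Ux// Uy// subr0. Qed.

Lemma orthocomp_closure U x : orthocomp dot U x -> orthocomp dot (closure U) x.
Proof.
move=> Ux u /closure_distP clu; apply/eqP; rewrite -normr_le0.
apply/ler_addgt0Pl => e e0; rewrite addr0.
have k0 : 0 < `|x| + 1 by rewrite ltr_wpDl.
have [v Uv uv] := clu _ (divr_gt0 e0 k0).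
rewrite -[u](subrK v) dotDr (Ux v Uv) addr0.
apply: le_trans (CauchySchwarz_norm dot_norm _ _) _.
apply: le_trans (_ : (`|x| + 1) * (e / (`|x| + 1)) <= _).
  by apply: ler_pM => //; [rewrite lerDl|exact: ltW].
by rewrite mulrC divfK// gt_eqF.
Qed.

Lemma orthocomp_dense U x : dense U -> orthocomp dot U x -> x = 0.
Proof.
move=> dU Ux; apply: (dotxx_eq0 dot_norm); apply: (orthocomp_closure Ux).
apply/closure_distP => e e0.
have [y [xy Uy]] := dU _ (ex_intro _ x (ballxx x e0)) (ball_open x e).
by exists y => //; move: xy; rewrite -[_ x e y]/(ball x e y) -ball_normE.
Qed.

Lemma orthocomp_self U x : U x -> orthocomp dot U x -> x = 0.
Proof. by move=> Ux /(_ x Ux) /(dotxx_eq0 dot_norm). Qed.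

Lemma dot_sym0 x y : dot x y = 0 -> dot y x = 0.
Proof. by move=> xy; rewrite dotC xy rmorph0. Qed.

Lemma dot_inj x y : (forall u, dot u x = dot u y) -> x = y.
Proof.
move=> xy; apply: subr0_eq; apply: (dotxx_eq0 dot_norm).
by rewrite dotBr xy subrr.
Qed.

Lemma pr_unique U f u : subspace U -> U u -> orthocomp dot U (f - u) ->
  pr dot U f = u.
Proof.
move=> sU Uu Ufu; apply: xget_unique => // v [Uv Ufv].
apply: subr0_eq; apply: (@orthocomp_self U); first exact: subspaceB.
have -> : v - u = (f - u) - (f - v) by rewrite opprB [RHS]addrC addrA subrK.
exact: orthocomp_sub.
Qed.

Lemma prP U f : closed U -> subspace U ->
  U (pr dot U f) /\ orthocomp dot U (f - pr dot U f).
Proof.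
move=> clU sU; suff ex : exists u, U u /\ orthocomp dot U (f - u).
  exact: (@xgetPex _ 0 _ ex).
(* [U] is embedded as [U x {0}] to reuse the projection theorem for pairs. *)
pose C : set (H * H) := [set p | U p.1 /\ p.2 = 0].
have clC : closed C.
  move=> [u v] /closure_distP clp; split=> /=.
    apply: closed_dist => // e /clp[[u' v'] [/= Uu' _] lte].
    exists u' => //; apply: le_lt_trans lte.
    exact: (norm_pair_le ((u, v) - (u', v'))).1.
  apply/eqP; rewrite -normr_le0; apply/ler_addgt0Pl => e e0; rewrite addr0.
  have [[u' v'] [/= _ ->] /ltW] := clp _ e0; apply: le_trans.
  by have := (norm_pair_le ((u, v) - (u', 0))).2; rewrite /= subr0.
have sC : subspace C.
  split=> [|a [u ?] [v ?] [/= Uu ->] [/= Uv ->]]; first by split=> //; exact: sU.1.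
  by split; [exact: sU.2|rewrite /= scaler0 addr0].
have [[c c'] [/= Uc _] cP] := pair_projection dot_norm (f, 0) clC sC.
exists c; split=> // u Uu.
have := cP (u, 0) (conj Uu erefl).
by rewrite /pair_dot /= dot0r addr0.
Qed.

Lemma pr_in U f : closed U -> subspace U -> U (pr dot U f).
Proof. by move=> clU sU; have [] := prP f clU sU. Qed.

Lemma pr_id U f : subspace U -> U f -> pr dot U f = f.
Proof. by move=> sU Uf; apply: pr_unique => // u _; rewrite subrr dot0l. Qed.

Lemma pr_eq U f g : closed U -> subspace U -> orthocomp dot U (f - g) ->
  pr dot U f = pr dot U g.
Proof.
move=> clU sU fg; apply: pr_unique => //; first exact: pr_in.
rewrite -(subrK g f) -addrA => u Uu; rewrite dotDl fg// add0r.
by have [_ ->] := prP g clU sU.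
Qed.

Lemma prD U f g : closed U -> subspace U ->
  pr dot U (f + g) = pr dot U f + pr dot U g.
Proof.
move=> clU sU; have [Uf oUf] := prP f clU sU; have [Ug oUg] := prP g clU sU.
apply: pr_unique => //; first exact: subspaceD.
by move=> u Uu; rewrite opprD addrACA dotDl oUf// oUg// addr0.
Qed.

Lemma dot_pr U f u : closed U -> subspace U -> U u -> dot u (pr dot U f) = dot u f.
Proof.
move=> clU sU Uu; have [_ /(_ u Uu) /dot_sym0] := prP f clU sU.
by rewrite dotBr => /subr0_eq ->.
Qed.

Lemma closed_subspace_full U : closed U -> subspace U ->
  (forall x, orthocomp dot U x -> x = 0) -> U = setT.
Proof.
move=> clU sU U0; rewrite -subTset => x _.
by have [Ux /U0 /subr0_eq ->] := prP x clU sU.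
Qed.

(* Riesz representation: the kernel of [f |-> dot (S f) y] has an orthogonal
   vector [e], and a multiple of [e] represents the functional. *)
Lemma bounded_op_adjoint S : bounded_op S ->
  exists2 S' : H -> H, bounded_op S' & forall f y, dot (S f) y = dot f (S' y).
Proof.
move=> bS; have [c c0 bc] := bounded_op_bound bS.
suff : forall y, exists x, forall f, dot (S f) y = dot f x.
  move=> /choice[S' S'P]; exists S' => //; apply: bounded_opI => [a u v|].
    by apply: dot_inj => f; rewrite -S'P !dotDr !dotZr !S'P.
  exists c => y; have [->|S'y0] := eqVneq (S' y) 0.
    by rewrite normr0 mulr_ge0// ltW.
  have nS : 0 < `|S' y| by rewrite normr_gt0.
  rewrite -(ler_pM2l nS) -expr2 -dot_norm -S'P.
  apply: le_trans (real_ler_norm _) _.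
    by rewrite S'P dot_norm realX// normr_real.
  apply: le_trans (CauchySchwarz_norm dot_norm _ _) _.
  by rewrite mulrA [`|S' y| * c]mulrC ler_wpM2r.
move=> y; pose N : set H := [set f | dot (S f) y = 0].
have sN : subspace N.
  split=> [|a u v]; first by rewrite /N /= (bounded_op0 bS) dot0l.
  rewrite /N /= (bounded_opD _ _ bS) (bounded_opZ _ _ bS) dotDl dotZl => -> ->.
  by rewrite mulr0 addr0.
have clN : closed N.
  move=> f clf; apply: dot_sym0; pose O : set H := [set g | dot y g = 0].
  have /orthocomp_closure : orthocomp dot O y by [].
  apply; apply: bounded_op_closure clf => // g Ng; apply: subset_closure.
  exact: dot_sym0.
have [allN|/existsNP[f0 Nf0]] := pselect (forall f, N f).
  by exists 0 => f; rewrite dot0r allN.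
have [Np oNe] := prP f0 clN sN; set p := pr dot N f0 in Np oNe.
set e := f0 - p in oNe.
have ye : dot (S e) y != 0.
  by rewrite (bounded_opB _ _ bS) dotBl Np subr0; apply/eqP.
have e0 : e != 0.
  by apply: contraNneq ye => ->; rewrite (bounded_op0 bS) dot0l.
have ee0 : dot e e != 0 by rewrite dot_norm expf_neq0// normr_eq0.
exists ((dot (S e) y / dot e e)^* *: e) => f.
have : N (f - (dot (S f) y / dot (S e) y) *: e).
  rewrite /N /= (bounded_opB _ _ bS) (bounded_opZ _ _ bS) dotBl dotZl divfK//.
  by rewrite subrr.
move=> /oNe/dot_sym0; rewrite dotBl dotZl => /subr0_eq fe.
rewrite dotZr conjCK fe; field.
by rewrite ee0 ye.
Qed.

Lemma linear_adjoint A : dense (dom A) -> linear_operator (adjoint dot A).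
Proof.
move=> dA; split.
- by move=> u f _; rewrite /= !dot0r.
- move=> a [u f] [v g] Au Av x y Axy; rewrite /= !dotDr !dotZr.
  by rewrite (Au x y Axy) (Av x y Axy).
- move=> u f g Af Ag; apply: subr0_eq; apply: (orthocomp_dense dA).
  move=> x [y Axy]; apply: dot_sym0.
  by rewrite dotBr -(Af _ _ Axy) -(Ag _ _ Axy) subrr.
Qed.

(** If [(h, k)] is the residue of [(x, y)] after projection onto the graph, orthogonality says that
    [(k, - h)] lies in the adjoint. The assumption at this point makes the residue orthogonal to
    [(x, y)] as well, hence zero. *)
Lemma adjoint_double A : closed A -> linear_operator A -> forall x y,
  (forall u f, adjoint dot A (u, f) -> dot y u = dot x f) -> A (x, y).
Proof.
move=> clA lA x y xyP; have sA : subspace A by case: lA => A0 lA _; split.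
have [[c1 c2] Ac cP] := pair_projection dot_norm (x, y) clA sA.
pose h := x - c1; pose k := y - c2.
have hk u f : A (u, f) -> dot h u + dot k f = 0 by move=> /cP.
have : adjoint dot A (k, - h).
  move=> u f /hk /eqP; rewrite addrC addr_eq0 => /eqP e.
  by rewrite dotC e rmorphN /= -dotC dotNr.
move=> /xyP; rewrite dotNr => /eqP; rewrite -addr_eq0 => /eqP e1.
have /hk e2 := Ac.
have : dot h h + dot k k = 0.
  rewrite {2}/h {2}/k !dotBr.
  have -> : dot h x - dot h c1 + (dot k y - dot k c2) =
     (dot y k + dot x h)^* - (dot h c1 + dot k c2).
    by rewrite rmorphD /= -!dotC; ring.
  by rewrite e1 e2 rmorph0 subr0.
move=> /eqP; rewrite !dot_norm paddr_eq0 ?exprn_ge0//.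
rewrite !expf_eq0 /= !normr_eq0 => /andP[/eqP /subr0_eq -> /eqP /subr0_eq ->].
exact: Ac.
Qed.

(** The bounded adjoint [S] of the resolvent inverts [adjoint dot A - l^*] on both sides: [inS]
    gives surjectivity, [unS] gives injectivity and the bound. *)
Lemma resolvent_adjoint A l : linear_operator A -> resolvent_set A l ->
  resolvent_set (adjoint dot A) l^* /\
  forall f g, dot (resolvent A l f) g = dot f (resolvent (adjoint dot A) l^* g).
Proof.
move=> lA rl; have bR := resolvent_bounded lA rl.
have [S bS SP] := bounded_op_adjoint bR.
have inS g : adjoint dot A (S g, g + l^* *: S g).
  move=> u f Auf; have ug : dot u g = dot (f - l *: u) (S g).
    by rewrite -SP (@resolvent_eq _ _ A l u)// subrK.
  by rewrite /= dotDr dotZr conjCK ug dotBl dotZl subrK.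
have unS u f : adjoint dot A (u, f + l^* *: u) -> u = S f.
  move=> uf; apply: dot_inj => h; rewrite -SP.
  have := uf _ _ (resolventP h rl).
  by rewrite /= dotDl dotZl dotDr dotZr conjCK => /addIr.
have rS : resolvent_set (adjoint dot A) l^*.
  split.
  - rewrite eqEsubset; split=> [u|_ ->]; rewrite /ker /op_shift /=.
      by move/unS; rewrite (bounded_op0 bS).
    by have := inS 0; rewrite (bounded_op0 bS).
  - by rewrite -subTset => g _; exists (S g); exact: inS.
  - have [c _ cP] := bounded_op_bound bS; exists c => u f /unS /= ->.
    exact: cP.
split=> // f g; rewrite SP.
by rewrite -(unS _ _ (resolventP g rS)).
Qed.

(** No Neumann series is summed. If [|m - l|] is below [(c * 2)^-1], rewriting [A - m] as a
    perturbation of [A - l] costs at most half of [|u|], which is absorbed on the left; this gives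
    the bound and injectivity. Surjectivity follows once the range is closed and has no nonzero
    orthogonal vector. *)
Lemma resolvent_set_near A l : closed A -> linear_operator A -> resolvent_set A l ->
  exists c d : R[i], [/\ 0 < c, 0 < d & forall m, `|m - l| < d ->
    resolvent_set A m /\ forall f, `|resolvent A m f| <= c * `|f|].
Proof.
move=> clA lA rl; have bR := resolvent_bounded lA rl.
have [c c0 bc] := bounded_op_bound bR; have c20 : 0 < c * 2 by rewrite mulr_gt0.
exists (c * 2), (c * 2)^-1; split; rewrite ?invr_gt0// => m ml.
have bound u f : A (u, f + m *: u) -> `|u| <= c * 2 * `|f|.
  move=> Auf; have : resolvent A l (f + (m - l) *: u) = u.
    by apply: resolvent_eq => //; rewrite scalerBl -addrA subrK.
  have := bc (f + (m - l) *: u) => /[swap] -> h.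
  have : `|u| <= c * `|f| + `|u| / 2.
    apply: le_trans h _; apply: le_trans (_ : c * (`|f| + `|m - l| * `|u|) <= _).
      by rewrite ler_pM2l// -normrZ ler_normD.
    rewrite mulrDr lerD2l mulrA [leRHS]mulrC ler_wpM2r//.
    by rewrite mulrC -ler_pdivlMr// -invfM mulrC ltW// mulrC.
  rewrite -lerBlDr {1}[`|u|]splitr addrK ler_pdivrMr//.
  by rewrite mulrAC.
have lAm := op_shift_linear m lA.
have ran_full : ran (op_shift A m) = setT.
  have sub : subspace (ran (op_shift A m)).
    split; first by exists 0; case: lAm.
    move=> a f g [u Au] [v Av]; exists (a *: u + v).
    by apply: linear_operatorD => //; exact: linear_operatorZ.
  apply: closed_subspace_full => // [f /closure_distP clf|f of_].
    (* Closed range: images converging to [f] have preimages that are Cauchy by [bound], and [A] is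
       closed. *)
    have [u uP] : exists u : nat -> H * H, forall n,
        op_shift A m (u n) /\ `|f - (u n).2| < n.+1%:R^-1.
      suff : forall n : nat, exists p : H * H,
          op_shift A m p /\ `|f - p.2| < n.+1%:R^-1.
        by move=> /choice[w wP]; exists w.
      move=> n; have [|g [u Au] fg] := clf n.+1%:R^-1; first by rewrite invr_gt0.
      by exists (u, g).
    have conv2 (e : R[i]) : 0 < e ->
        exists N, forall n, (N <= n)%N -> `|f - (u n).2| < e.
      move=> /archi_inv[N NP]; exists N => n Nn.
      apply: lt_trans (uP n).2 _; apply: le_lt_trans NP.
      by rewrite lef_pV2 ?posrE ?ltr0n// ler_nat ltnS.
    have [v vP] : exists v, forall e : R[i], 0 < e ->
        exists N, forall n, (N <= n)%N -> `|v - (u n).1| < e.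
      apply: (@seq_complete R H (fun n => (u n).1)) => e e0.
      have [N NP] := conv2 _ (divr_gt0 (divr_gt0 e0 c20) (ltr0Sn _ 1)).
      exists N => i j Ni Nj.
      have Aij : A ((u i).1 - (u j).1, (u i).2 - (u j).2 + m *: ((u i).1 - (u j).1)).
        have := (uP i).1; have := (uP j).1.
        case: (u i) (u j) => u1 u2 [v1 v2] /= Av Au.
        exact: (linear_operatorB lAm Au Av).
      apply: le_lt_trans (bound _ _ Aij) _; rewrite mulrC -ltr_pdivlMr//.
      by apply: (@distm_lt_splitr _ _ f); exact: NP.
    exists v; apply: (closed_dist clA) => e e0.
    have k0 : 0 < `|m| + 2 by rewrite ltr_wpDl.
    have ek0 := divr_gt0 e0 k0.
    have [N1 N1P] := vP _ ek0; have [N2 N2P] := conv2 _ ek0.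
    pose n := maxn N1 N2; exists ((u n).1, (u n).2 + m *: (u n).1).
      exact: (uP n).1.
    have n1 := N1P n (leq_maxl _ _); have n2 := N2P n (leq_maxr _ _).
    apply: norm_pair_lt => /=.
      apply: lt_le_trans n1 _; rewrite ler_pdivrMr// ler_peMr ?(ltW e0)//.
      by rewrite ler_wpDl// ler1n.
    rewrite opprD addrACA -scalerBr (le_lt_trans (ler_normD _ _))// normrZ.
    apply: le_lt_trans (lerD (ltW n2) (ler_wpM2l (normr_ge0 m) (ltW n1))) _.
    rewrite -{1}[e / _]mul1r -mulrDl mulrCA -[ltRHS]mulr1 ltr_pM2l//.
    by rewrite ltr_pdivrMr// mul1r addrC ltrD2l ltr1n.
  (* The vector [f + (l - m) *: g] is in the range of [A - m]. As [f] is orthogonal to it and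
     [(l - m) *: g] has norm at most [|f| / 2], [f] vanishes. *)
  have [g Ag] : exists g, A (g, f + l *: g).
    by exists (resolvent A l f); exact: resolventP.
  have : dot f (f + (l - m) *: g) = 0.
    by apply: of_; exists g; rewrite /op_shift /= scalerBl addrA subrK.
  have gE : resolvent A l f = g by exact: resolvent_eq.
  rewrite -gE dotDr => /eqP; rewrite addr_eq0 => /eqP ff.
  have : `|dot f f| <= `|f| ^+ 2 / 2.
    rewrite ff normrN.
    apply: le_trans (CauchySchwarz_norm dot_norm _ _) _.
    rewrite expr2 -mulrA ler_wpM2l// normrZ distrC.
    apply: le_trans (_ : `|m - l| * (c * `|f|) <= _); first by rewrite ler_wpM2l.
    rewrite mulrA [leRHS]mulrC ler_wpM2r//.
    by rewrite -ler_pdivlMr// -invfM mulrC ltW// mulrC.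
  rewrite dot_norm ger0_norm ?exprn_ge0// -subr_le0 {1}[_ ^+ 2]splitr addrK.
  rewrite pmulr_lle0 ?invr_gt0//.
  move=> f0; apply: (dotxx_eq0 dot_norm); apply/le_anti.
  by rewrite dot_norm f0 exprn_ge0.
have ker0 : ker (op_shift A m) = [set 0].
  rewrite eqEsubset; split=> [u|_ ->]; last by case: lAm.
  rewrite /ker /op_shift /= => /bound; rewrite normr0 mulr0 normr_le0.
  by move=> /eqP.
have rm : resolvent_set A m by split=> //; exists (c * 2) => u f; exact: bound.
by split=> // f; apply: bound; exact: resolventP.
Qed.

End Hilbert.

(** * The projections along a reference operator *)

Section Projections.
Context {R : realType} {H : completeNormedModType R[i]}.
Variable dot : {dot H for Num.conj}.
Hypothesis dot_norm : forall x : H, dot x x = `|x| ^+ 2.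
Implicit Types (A B C : set (H * H)) (U : set H) (u f g h x y : H).

Lemma dot_injl x y : (forall u, dot x u = dot y u) -> x = y.
Proof.
move=> xy; apply: subr0_eq; apply: (dotxx_eq0 dot_norm).
by rewrite dotBl xy subrr.
Qed.

(* Vector identities are checked by pairing with an arbitrary vector, which
   turns them into ring identities. *)
Ltac vec := apply: dot_injl => ?; rewrite ?(dotDl, dotNl, dotZl, dot0l); ring.

Lemma op_shift0 A : op_shift A 0 = A.
Proof.
by apply/funext => -[u f]; rewrite /op_shift /= scale0r addr0.
Qed.

Lemma app_op_inv A : app (op_inv A) = resolvent A 0.
Proof. by apply/funext => f; rewrite /resolvent op_shift0. Qed.

Lemma adjoint_sub A B : A `<=` B -> adjoint dot B `<=` adjoint dot A.
Proof. by move=> AB p Bp u f /AB; exact: Bp. Qed.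

(** [adjoint_on] tests against [U] only, so it is the compression to [U] of an adjoint known on all
    of [H]. *)
Lemma adjoint_onE U (S1 S2 : H -> H) y : closed U -> subspace U ->
  (forall u x, dot (S1 u) x = dot u (S2 x)) ->
  adjoint_on dot U S1 y = pr dot U (S2 y).
Proof.
move=> clU sU S12; apply: xget_unique.
  split=> [|u Uu]; first exact: pr_in.
  by rewrite dot_pr// S12.
move=> x [Ux xP]; apply/esym/pr_unique => // u Uu; apply: dot_sym0.
by rewrite dotBr -S12 xP// subrr.
Qed.

(** The kernel of the adjoint is the orthogonal complement of [ran A]. *)
Lemma closed_ker_adjoint A : closed (ker (adjoint dot A)).
Proof.
move=> x clx u f Auf; rewrite /= dot0r; apply: dot_sym0.
have /orthocomp_closure : orthocomp dot [set y | dot f y = 0] f by [].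
move=> /(_ dot_norm x) fx; apply: dot_sym0; apply: fx; move: x clx.
by apply: closure_subset => y /(_ u f Auf); rewrite /= dot0r.
Qed.

Section OneExtension.
Variables B C : set (H * H).
Hypotheses (lB : linear_operator B) (lC : linear_operator C) (BC : B `<=` C).
Hypothesis B0 : resolvent_set B 0.
Let S := resolvent B 0.

Lemma resolvent0P f : B (S f, f).
Proof. by have := resolventP f B0; rewrite scale0r addr0. Qed.

Lemma resolvent0_eq u f : B (u, f) -> S f = u.
Proof. by move=> Buf; apply: resolvent_eq => //; rewrite scale0r addr0. Qed.

Lemma resolvent0_bounded : bounded_op S.
Proof. exact: resolvent_bounded. Qed.

Lemma pr_alongE u f : C (u, f) -> pr_along B C u = u - S f.
Proof. by move=> Cuf; rewrite /pr_along app_op_inv (appE lC Cuf). Qed.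

Lemma pr_along_shiftE l u f : C (u, f) ->
  pr_along (op_shift B l) (op_shift C l) u = u - resolvent B l (f - l *: u).
Proof.
by move=> Cuf; rewrite /pr_along app_op_shift//; [rewrite (appE lC Cuf)|exists f].
Qed.

Lemma pr_along_linear (a : R[i]) u v : dom C u -> dom C v ->
  pr_along B C (a *: u + v) = a *: pr_along B C u + pr_along B C v.
Proof.
move=> [f Cu] [g Cv].
rewrite (pr_alongE Cu) (pr_alongE Cv) (@pr_alongE _ (a *: f + g)); last first.
  by apply: linear_operatorD => //; exact: linear_operatorZ.
have bS := resolvent0_bounded.
by rewrite (bounded_opD _ _ bS) (bounded_opZ _ _ bS); vec.
Qed.

Lemma pr_along_ker u : dom C u -> ker C (pr_along B C u).
Proof.
move=> [f Cu]; rewrite (pr_alongE Cu) /ker /= -(subrr f).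
by apply: linear_operatorB => //; apply: BC; exact: resolvent0P.
Qed.

Lemma subspace_pr_along D : linear_operator D -> D `<=` C ->
  subspace (closure (pr_along B C @` dom D)).
Proof.
move=> lD DC; apply: closure_subspace; split.
  exists 0; first by exists 0; case: lD.
  have C0 : C (0, 0) by case: lC.
  by rewrite (pr_alongE C0) (bounded_op0 resolvent0_bounded) subr0.
have domDC u : dom D u -> dom C u by move=> [f /DC]; exists f.
move=> a _ _ [u Du <-] [v Dv <-]; exists (a *: u + v).
  exact: (subspace_dom lD).2.
by rewrite pr_along_linear//; exact: domDC.
Qed.

(** * The maps [E] and [F] at a regular parameter *)

Section Shift.
Variable l : R[i].
Hypothesis Bl : resolvent_set B l.
Let Rl := resolvent B l.
Let E u := u + l *: Rl u.
Let F u := u - l *: S u.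

Lemma E_bounded : bounded_op E.
Proof.
apply: bounded_op_add; first exact: bounded_op_id.
by apply: bounded_op_scale; exact: resolvent_bounded.
Qed.

Lemma F_bounded : bounded_op F.
Proof.
apply: bounded_op_sub; first exact: bounded_op_id.
by apply: bounded_op_scale; exact: resolvent_bounded.
Qed.

(** This is the resolvent identity between the points [0] and [l]; [FK] uses it in the other
    order. *)
Lemma EK u : F (E u) = u.
Proof.
have bS := resolvent0_bounded.
rewrite /F /E (bounded_opD _ _ bS) (bounded_opZ _ _ bS).
have := resolvent_identity u lB B0 Bl; rewrite -/S -/Rl sub0r => SR.
have -> : S u = Rl u - l *: S (Rl u) by rewrite -scaleNr -SR addrC subrK.
by vec.
Qed.

Lemma FK u : E (F u) = u.
Proof.
have bR := resolvent_bounded lB Bl.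
rewrite /F /E /Rl (bounded_opB _ _ bR) (bounded_opZ _ _ bR).
have := resolvent_identity u lB Bl B0; rewrite -/S subr0 => RS.
have -> : resolvent B l u = S u + l *: resolvent B l (S u).
  by rewrite -RS addrC subrK.
by vec.
Qed.

(** Both sides contain [u + l *: Rl u]; what remains is [Rl f = S f + l *: Rl (S f)], again the
    resolvent identity. *)
Lemma E_pr_along u : dom C u ->
  E (pr_along B C u) = pr_along (op_shift B l) (op_shift C l) u.
Proof.
move=> [f Cu]; rewrite (pr_alongE Cu) (pr_along_shiftE _ Cu).
have bR := resolvent_bounded lB Bl.
rewrite /E /Rl !(bounded_opB _ _ bR) !(bounded_opZ _ _ bR).
have := resolvent_identity f lB Bl B0; rewrite -/S subr0 => RS.
have -> : resolvent B l f = S f + l *: resolvent B l (S f).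
  by rewrite -RS addrC subrK.
by vec.
Qed.

End Shift.
End OneExtension.

End Projections.

(** * The Krein resolvent formula *)

Section Krein.
Context {R : realType} {H : completeNormedModType R[i]}.
Variable dot : {dot H for Num.conj}.
Hypothesis dot_norm : forall x : H, dot x x = `|x| ^+ 2.
Variables Amin Amin' Ab At : set (H * H).
Hypothesis Amin_cdd : closed_densely_defined Amin.
Hypothesis Amin'_cdd : closed_densely_defined Amin'.
Hypothesis Ab_cdd : closed_densely_defined Ab.
Hypothesis Amin_Ab : Amin `<=` Ab.
Hypothesis Ab_Amax : Ab `<=` adjoint dot Amin'.
Hypothesis Ab0 : resolvent_set Ab 0.
Hypothesis At_cdd : closed_densely_defined At.
Hypothesis Amin_At : Amin `<=` At.
Hypothesis At_Amax : At `<=` adjoint dot Amin'.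

Let Amax := adjoint dot Amin'.
Let Amax' := adjoint dot Amin.
Let Ab' := adjoint dot Ab.
Let At' := adjoint dot At.
Let Z' := ker Amax'.
Let prz := pr_along Ab Amax.
Let prz' := pr_along Ab' Amax'.
Let V := closure (prz @` dom At).
Let W := closure (prz' @` dom At').
Let prz'_ (l : R[i]) := pr_along (op_shift Ab' l^*) (op_shift Amax' l^*).
Let prz_ l := pr_along (op_shift Ab l) (op_shift Amax l).
Let W_ (l : R[i]) := closure (prz'_ l @` dom At').
Let T := corresp_op dot prz Amax At W.
Let T_ l := corresp_op dot (prz_ l) (op_shift Amax l) At (W_ l).
Let S := resolvent Ab 0.
Let S' := resolvent Ab' 0.
Let E l u := u + l *: resolvent Ab l u.
Let F l u := u - l *: S u.
Let E' (l : R[i]) u := u + l^* *: resolvent Ab' l^* u.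
Let F' (l : R[i]) u := u - l^* *: app (op_inv Ab') u.
Let E'adj (l : R[i]) := adjoint_on dot W (E' l).
Let F'adj (l : R[i]) := adjoint_on dot (W_ l) (F' l).
Let G l z := - (l *: pr dot Z' (E l z)).
Let TG l := op_add T (fun z => pr dot W (G l z)).
Implicit Types (l : R[i]) (u f g h w x y z : H).

Ltac vec :=
  apply: (dot_injl dot_norm) => ?; rewrite ?(dotDl, dotNl, dotZl, dot0l); ring.

Let lAmax : linear_operator Amax.
Proof. by apply: (linear_adjoint dot_norm); case: Amin'_cdd. Qed.
Let lAmax' : linear_operator Amax'.
Proof. by apply: (linear_adjoint dot_norm); case: Amin_cdd. Qed.
Let lAb : linear_operator Ab. Proof. by case: Ab_cdd. Qed.
Let lAt : linear_operator At. Proof. by case: At_cdd. Qed.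
Let lAb' : linear_operator Ab'.
Proof. by apply: (linear_adjoint dot_norm); case: Ab_cdd. Qed.
Let lAt' : linear_operator At'.
Proof. by apply: (linear_adjoint dot_norm); case: At_cdd. Qed.
Let Ab'_Amax' : Ab' `<=` Amax'. Proof. exact: adjoint_sub. Qed.
Let At'_Amax' : At' `<=` Amax'. Proof. exact: adjoint_sub. Qed.

Let Ab'0 : resolvent_set Ab' 0.
Proof. by have [] := resolvent_adjoint dot_norm lAb Ab0; rewrite rmorph0. Qed.
Let dotS x y : dot (S x) y = dot x (S' y).
Proof.
by have [_] := resolvent_adjoint dot_norm lAb Ab0; rewrite rmorph0; apply.
Qed.
Let Ab'l l : resolvent_set Ab l -> resolvent_set Ab' l^*.
Proof. by move=> rl; have [] := resolvent_adjoint dot_norm lAb rl. Qed.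
Let dotE l x y : resolvent_set Ab l -> dot (E l x) y = dot x (E' l y).
Proof.
move=> rl; have [_ RP] := resolvent_adjoint dot_norm lAb rl.
by rewrite /E /E' dotDl dotDr dotZl dotZr conjCK RP.
Qed.
Let dotF l x y : dot (F l x) y = dot x (F' l y).
Proof.
by rewrite /F /F' app_op_inv dotBl dotBr dotZl dotZr conjCK dotS.
Qed.

Let sV : subspace V.
Proof. exact: subspace_pr_along. Qed.
Let sW : subspace W.
Proof. exact: subspace_pr_along. Qed.
Let clW : closed W. Proof. exact: closed_closure. Qed.
Let bS : bounded_op S. Proof. exact: resolvent_bounded. Qed.
Let bF l : bounded_op (F l). Proof. exact: F_bounded. Qed.

Let dom_At_Amax u : dom At u -> dom Amax u.
Proof. by move=> [f /At_Amax]; exists f. Qed.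
Let dom_At'_Amax' u : dom At' u -> dom Amax' u.
Proof. by move=> [f /At'_Amax']; exists f. Qed.

(** Lets the projection onto [W] absorb the projection onto [Z'] inside [G]. *)
Let W_Z' w : W w -> Z' w.
Proof.
move=> Ww; apply: (closed_ker_adjoint dot_norm); move: w Ww; apply: closure_subset.
by move=> _ [u /dom_At'_Amax' Du <-]; exact: pr_along_ker.
Qed.

(** For [(u, g)] in [At'], orthogonality of [h] to [prz' u = u - S' g] reads
    [dot h u = dot (S h) g], which is the criterion of [adjoint_double] for [(S h, h)]. *)
Lemma orthocomp_W_At h : orthocomp dot W h -> At (S h, h).
Proof.
move=> oWh; case: At_cdd => lA clA _; apply: (adjoint_double dot_norm clA lA).
move=> u g Atug; have : dot h (prz' u) = 0.
  by apply: oWh; apply: subset_closure; exists u => //; exists g.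
rewrite /prz' (pr_alongE _ lAmax' (At'_Amax' Atug)) dotBr => /subr0_eq ->.
by rewrite dotS.
Qed.

(** Converse of [orthocomp_W_At]. It makes [T] single valued: two elements of the domain of [At]
    with the same [prz] differ by an element of the domain of [Ab]. *)
Lemma At_Ab_orthocomp_W u f : At (u, f) -> Ab (u, f) -> orthocomp dot W f.
Proof.
move=> Atu Abu; apply: orthocomp_closure => // _ [u' [g Ag] <-].
rewrite /prz' (pr_alongE _ lAmax' (At'_Amax' Ag)) dotBr -dotS.
by rewrite /S (resolvent0_eq lAb Ab0 Abu) (Ag _ _ Atu) subrr.
Qed.

(** * Parameters regular for [Ab]: the graphs of [T + G] and [T^lambda], kernels and ranges *)

Section RegularBeta.
Variable l : R[i].
Hypothesis Abl : resolvent_set Ab l.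

Lemma E'_pr u : dom At' u -> E' l (prz' u) = prz'_ l u.
Proof.
by move=> /dom_At'_Amax'; exact: (E_pr_along dot_norm lAb' lAmax' Ab'0 (Ab'l Abl)).
Qed.

Lemma bE' : bounded_op (E' l).
Proof. exact: (E_bounded lAb' (Ab'l Abl)). Qed.

Lemma bF' : bounded_op (F' l).
Proof. by rewrite /F' app_op_inv; exact: F_bounded. Qed.

Lemma F'K u : E' l (F' l u) = u.
Proof. by rewrite /F' app_op_inv; exact: (FK dot_norm lAb' Ab'0 (Ab'l Abl)). Qed.

Lemma E'K u : F' l (E' l u) = u.
Proof. by rewrite /F' app_op_inv; exact: (EK dot_norm lAb' Ab'0 (Ab'l Abl)). Qed.

Lemma E'_W w : W w -> W_ l (E' l w).
Proof.
apply: (bounded_op_closure bE') => _ [u Du <-].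
by apply: subset_closure; exists u => //; rewrite E'_pr.
Qed.

Lemma F'_W y : W_ l y -> W (F' l y).
Proof.
apply: (bounded_op_closure bF') => _ [u Du <-].
by apply: subset_closure; exists u => //; rewrite -E'_pr// E'K.
Qed.

Lemma sW_ : subspace (W_ l).
Proof.
split=> [|a u v Wu Wv].
  by rewrite -[0](bounded_op0 bE'); apply: E'_W; exact: sW.1.
rewrite -[u]F'K -[v]F'K -(bounded_opZ _ _ bE') -(bounded_opD _ _ bE').
by apply: E'_W; apply: sW.2; exact: F'_W.
Qed.

Lemma clW_ : closed (W_ l). Proof. exact: closed_closure. Qed.

(** By duality: [F'], the adjoint of [F], carries [W_ l] into [W]. The same holds for [E] with [E']
    in the opposite direction. *)
Lemma orthocomp_F k : orthocomp dot W k -> orthocomp dot (W_ l) (F l k).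
Proof. by move=> oWk y /F'_W Wy; rewrite dotF; exact: oWk. Qed.

Lemma orthocomp_E k : orthocomp dot (W_ l) k -> orthocomp dot W (E l k).
Proof. by move=> oWk y /E'_W Wy; rewrite dotE//; exact: oWk. Qed.

Lemma E'adjE y : E'adj l y = pr dot W (E l y).
Proof.
apply: adjoint_onE => // u x; rewrite dotC -dotE// -dotC //.
Qed.

Lemma F'adjE y : F'adj l y = pr dot (W_ l) (F l y).
Proof.
apply: adjoint_onE => //; [exact: clW_|exact: sW_|].
by move=> u x; rewrite dotC -dotF -dotC.
Qed.

Lemma E_prz u : dom At u -> E l (prz u) = prz_ l u.
Proof.
by move=> Du; exact: (E_pr_along dot_norm lAb lAmax Ab0 Abl (dom_At_Amax Du)).
Qed.

Lemma E_przE u f : At (u, f) -> E l (prz u) = u - resolvent Ab l (f - l *: u).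
Proof.
move=> Auf; rewrite E_prz; last by exists f.
by rewrite /prz_ (pr_along_shiftE _ lAmax _ (At_Amax Auf)).
Qed.

(** Tested against [W], the projection onto [Z'] disappears from [G], leaving
    [f - l *: E l (prz u)]. Since [E l (prz u)] is [u] minus the resolvent of [Ab] at [f - l *: u],
    this equals [E l (f - l *: u)]. *)
Lemma pr_W_TG u f : At (u, f) ->
  pr dot W f + pr dot W (G l (prz u)) = pr dot W (E l (f - l *: u)).
Proof.
move=> Auf; rewrite -prD//; apply: pr_eq => // w Ww.
have clZ : closed Z' by exact: closed_ker_adjoint.
have sZ : subspace Z'.
  split=> [|a x y Zx Zy]; first by case: lAmax'.
  have := linear_operatorD lAmax' (linear_operatorZ a lAmax' Zx) Zy.
  by rewrite scaler0 addr0.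
have [_ /(_ w (W_Z' Ww))] := prP dot_norm (E l (prz u)) clZ sZ.
rewrite dotBl => /subr0_eq oZ.
rewrite dotBl dotDl /G dotNl dotZl -oZ (E_przE Auf) /E.
by rewrite !(dotDl, dotNl, dotZl); ring.
Qed.

Lemma FlK u : E l (F l u) = u. Proof. exact: FK. Qed.
Lemma ElK u : F l (E l u) = u. Proof. exact: EK. Qed.

Lemma TGE z w : TG l (z, w) <->
  exists u f, [/\ At (u, f), z = prz u & w = pr dot W (E l (f - l *: u))].
Proof.
rewrite /TG /op_add /T /corresp_op /=; split.
  move=> [u [f Auf] [<-]]; rewrite (appE lAmax (At_Amax Auf)) => fw.
  exists u, f; split=> //; rewrite -(pr_W_TG Auf) fw subrK //.
move=> [u [f [Auf -> ->]]]; exists u; first by exists f.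
by rewrite (appE lAmax (At_Amax Auf)) -(pr_W_TG Auf) addrK.
Qed.

Lemma T_E z y : T_ l (z, y) <->
  exists u f, [/\ At (u, f), z = E l (prz u) & y = pr dot (W_ l) (f - l *: u)].
Proof.
have appl u f : At (u, f) -> app (op_shift Amax l) u = f - l *: u.
  move=> Auf; rewrite app_op_shift ?(appE lAmax (At_Amax Auf))//.
  by exists f; exact: At_Amax.
rewrite /T_ /corresp_op /=; split.
  move=> [u [f Auf] [<- <-]]; exists u, f.
  by rewrite (appl _ _ Auf) E_prz//; exists f.
move=> [u [f [Auf -> ->]]]; exists u; first by exists f.
by rewrite (appl _ _ Auf) E_prz//; exists f.
Qed.

(** If [At u = l *: u], the resolvent term of [E l (prz u)] vanishes, so [E l (prz u) = u].
    Conversely a kernel element of [TG l] comes from some [u] that is an eigenvector only up to the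
    correction [S h] below. *)
Lemma ker_shift_TG : ker (op_shift At l) = E l @` ker (TG l).
Proof.
rewrite eqEsubset; split=> [u|_ [z /TGE[u [f [Auf -> oh]]] <-]].
  rewrite /ker /op_shift /= => Au.
  have ul0 : 0 + l *: u - l *: u = 0 by rewrite addrK.
  exists (prz u).
    apply/TGE; exists u, (0 + l *: u); rewrite ul0; split=> //.
    have -> : E l 0 = 0 by exact: (bounded_op0 (E_bounded lAb Abl)).
    by rewrite pr_id//; exact: sW.1.
  by rewrite (E_przE Au) ul0 (bounded_op0 (resolvent_bounded lAb Abl)) subr0.
(* As [h] is orthogonal to [W], [S h] is in the domain of [At], and [At - l] sends it to
   [F l h = f - l *: u], its value at [u]. So [u - S h] is an eigenvector. *)
set h := E l (f - l *: u) in oh.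
have oWh : orthocomp dot W h.
  by have [_] := prP dot_norm h clW sW; rewrite -oh subr0.
have fE : f - l *: u = h - l *: S h by rewrite -/(F l h) /h ElK.
have := linear_operatorB lAt Auf (orthocomp_W_At oWh).
suff -> : E l (prz u) = u - S h.
  rewrite /ker /op_shift /= add0r.
  congr (At (_, _)); rewrite scalerBr; apply/eqP; rewrite -subr_eq0; apply/eqP.
  by rewrite -[f](subrK (l *: u)) fE; vec.
rewrite (E_przE Auf) fE; congr (u - _).
by apply: resolvent_eq => //; rewrite subrK; exact: resolvent0P.
Qed.

(** [F'adj l] maps [ran (TG l)] onto the projection of [ran (At - l)] to [W_ l]. It remains to see
    that the range contains the whole complement of [W_ l]: for [k] there, [S (E l k)] is in the
    domain of [At] and is sent to [F l (E l k) = k]. *)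
Lemma ran_shift_TG : ran (op_shift At l) =
  [set y + h | y in F'adj l @` ran (TG l) & h in orthocomp dot (W_ l)].
Proof.
have clWl := clW_; have sWl := sW_.
have F'adj_E f : F'adj l (pr dot W (E l f)) = pr dot (W_ l) f.
  rewrite F'adjE -{2}[f]ElK; apply: pr_eq => //.
  rewrite -(bounded_opB _ _ (bF l)); apply: orthocomp_F.
  have [_ o] := prP dot_norm (E l f) clW sW.
  by move=> w Ww; rewrite -opprB dotNl o// oppr0.
rewrite eqEsubset; split=> [f [u Auf]|].
  exists (pr dot (W_ l) f); last first.
    exists (f - pr dot (W_ l) f); first by have [] := prP dot_norm f clWl sWl.
    by rewrite addrC subrK.
  exists (pr dot W (E l f)); last exact: F'adj_E.
  exists (prz u); apply/TGE; exists u, (f + l *: u); split=> //.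
  by rewrite addrK.
move=> _ [_ [_ [z /TGE[u [f [Auf _ ->]]]] <-] [h oh <-]]; rewrite F'adj_E.
have ran_orth k : orthocomp dot (W_ l) k -> exists v, At (v, k + l *: v).
  move=> /orthocomp_E/orthocomp_W_At Ak; exists (S (E l k)).
  by rewrite -{2}[k]ElK /F subrK.
have [_ ok] := prP dot_norm (f - l *: u) clWl sWl.
have ohk := orthocomp_sub oh ok.
have [v Av] := ran_orth _ ohk; exists (u + v); rewrite /op_shift /=.
have := linear_operatorD lAt Auf Av.
congr (At (_, _)); vec.
Qed.

End RegularBeta.

(** * The function [M] on the resolvent set of [At] *)

Section RegularTilde.
Variable l : R[i].
Hypothesis Atl : resolvent_set At l.
Let Rt := resolvent At l.
Let bRt : bounded_op Rt. Proof. exact: resolvent_bounded. Qed.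

Lemma prz_resolvent g : prz (Rt g) = F l (Rt g) - S g.
Proof.
rewrite /prz (pr_alongE _ lAmax (At_Amax (resolventP g Atl))) -/Rt -/S.
by rewrite (bounded_opD _ _ bS) (bounded_opZ _ _ bS) /F; vec.
Qed.

(** In the theorem's formula [prz (S w) = 0] and [(Amax - l) (S w) = F l w], which leaves
    [- prz (Rt (F l w))]; [prz_resolvent] expands this into the present form, defined on all of
    [H]. *)
Definition krein_M w := S (F l w) - F l (Rt (F l w)).

Lemma krein_M_prz w : krein_M w = - prz (Rt (F l w)).
Proof. by rewrite prz_resolvent opprB. Qed.

Lemma krein_M_bounded : bounded_op krein_M.
Proof.
apply: bounded_op_sub; first exact: bounded_op_comp.
by apply: bounded_op_comp => //; exact: bounded_op_comp.
Qed.

Lemma krein_M_V w : V (krein_M w).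
Proof.
rewrite krein_M_prz; apply: (subspaceN sV); apply: subset_closure.
exists (Rt (F l w)) => //; exists (F l w + l *: Rt (F l w)).
exact: resolventP.
Qed.

(** Here [(At - l) (S h) = F l h], so [Rt] returns [S h], on which [prz] vanishes. *)
Lemma krein_M_orthocomp h : orthocomp dot W h -> krein_M h = 0.
Proof.
move=> /orthocomp_W_At Ah; have Rh : Rt (F l h) = S h.
  by apply: resolvent_eq => //; rewrite /F subrK.
rewrite krein_M_prz prz_resolvent Rh /F (bounded_opB _ _ bS) (bounded_opZ _ _ bS).
by vec.
Qed.

Lemma krein_M_pr g : krein_M (pr dot W g) = krein_M g.
Proof.
have [_ /krein_M_orthocomp] := prP dot_norm g clW sW.
by rewrite (bounded_opB _ _ krein_M_bounded) => /subr0_eq.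
Qed.

Lemma krein_M_formula w :
  krein_M w = prz (S w - Rt (app (op_shift Amax l) (S w))).
Proof.
have Sw : Amax (S w, w) by apply: Ab_Amax; exact: resolvent0P.
have -> : app (op_shift Amax l) (S w) = F l w.
  by rewrite app_op_shift ?(appE lAmax Sw)//; exists w.
have DR : dom Amax (Rt (F l w)).
  by exists (F l w + l *: Rt (F l w)); apply: At_Amax; exact: resolventP.
rewrite krein_M_prz; have -> : S w - Rt (F l w) = (-1) *: Rt (F l w) + S w by vec.
rewrite /prz (pr_along_linear dot_norm lAb lAmax Ab0)//; last by exists w.
by rewrite [pr_along _ _ (S w)](pr_alongE _ lAmax Sw) subrr addr0 scaleN1r.
Qed.

(** Pick [v] in the domain of [At] with [prz v = prz z] and [At v = f]. Projections onto [W] drop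
    out under [krein_M], so its argument becomes [l *: z - f]. Equality of the projections gives
    [F l (l *: z - f) = l *: v - f], that is [- (At - l) v], and [Rt] returns [- v]. *)
Lemma krein_M_eigen z : ker (op_shift Amax l) z -> dom T (prz z) ->
  krein_M (pr dot W (app Amax z) - app T (prz z)) = prz z.
Proof.
rewrite /ker /op_shift /= add0r => Zz DT.
(* [T] is single valued, so that [app T] is its genuine value and not a choice. *)
have Tu u v f g : At (u, f) -> At (v, g) -> prz u = prz v -> pr dot W f = pr dot W g.
  move=> Au Av; rewrite /prz (pr_alongE _ lAmax (At_Amax Au)).
  rewrite (pr_alongE _ lAmax (At_Amax Av)) => uv.
  apply: pr_eq => //; have Auv := linear_operatorB lAt Au Av.
  apply: (At_Ab_orthocomp_W Auv).
  have -> : u - v = S (f - g); last exact: resolvent0P.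
  rewrite (bounded_opB _ _ bS); apply: (addIr (- S f)).
  by rewrite addrAC uv; vec.
have [_ [v [f Av] [vz _]]] := DT.
have -> : app T (prz z) = pr dot W f.
  apply: xget_unique.
    by exists v; [exists f|rewrite vz (appE lAmax (At_Amax Av))].
  move=> g [u [k Au] [uz <-]]; rewrite (appE lAmax (At_Amax Au)).
  by apply: Tu Au Av _; rewrite uz.
rewrite (appE lAmax Zz) (bounded_opB _ _ krein_M_bounded) !krein_M_pr.
rewrite -(bounded_opB _ _ krein_M_bounded).
have zv : z - S (l *: z) = v - S f.
  rewrite -(pr_alongE Ab lAmax Zz) -(pr_alongE Ab lAmax (At_Amax Av)).
  by rewrite -/prz vz.
rewrite krein_M_prz.
have FE : F l (l *: z - f) = l *: v - f.
  rewrite /F (bounded_opB _ _ bS).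
  have -> : S f = v - (z - S (l *: z)) by rewrite zv opprB addrC subrK.
  by vec.
have -> : Rt (F l (l *: z - f)) = - v.
  rewrite FE -opprB (bounded_opN _ bRt); congr (- _).
  by apply: resolvent_eq => //; rewrite subrK.
have Dv : dom Amax v by exists f; exact: At_Amax.
have D0 : dom Amax 0 by exists 0; case: lAmax.
have -> : - v = (-1) *: v + 0 by vec.
rewrite /prz (pr_along_linear dot_norm lAb lAmax Ab0)// -/prz vz.
have A0 : Amax (0, 0) by case: lAmax.
rewrite /prz (pr_alongE _ lAmax A0) -/S (bounded_op0 bS) subr0 addr0.
by rewrite scaleN1r opprK.
Qed.

(** * Parameters regular for both operators: the inverses and the resolvent formula *)

Section BothRegular.
Hypothesis Abl : resolvent_set Ab l.

Lemma krein_M_E g : krein_M (E l g) = - prz (Rt g).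
Proof. by rewrite krein_M_prz ElK. Qed.

Lemma op_inv_TG : op_inv (TG l) = op_on W (fun w => - krein_M w).
Proof.
apply/seteqP; split=> -[w z]; rewrite /op_inv /op_on /=.
  move=> /(TGE Abl)[u [f [Auf -> ->]]]; split; first exact: pr_in.
  rewrite krein_M_pr krein_M_E opprK; congr prz; apply/esym.
  by apply: resolvent_eq => //; rewrite subrK.
move=> [Ww ->]; apply/(TGE Abl).
exists (Rt (F l w)), (F l w + l *: Rt (F l w)); split.
- exact: resolventP.
- by rewrite krein_M_prz opprK.
- by rewrite addrK FlK// pr_id.
Qed.

(** [E l] moves the component orthogonal to [W_ l] into the complement of [W], where [krein_M]
    vanishes, and [krein_M (E l g)] is [- prz (Rt g)]. *)
Lemma prz_resolvent_pr g : prz (Rt (pr dot (W_ l) g)) = prz (Rt g).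
Proof.
have [_] := prP dot_norm g (clW_ (l := l)) (sW_ Abl).
move=> /(orthocomp_E Abl)/krein_M_orthocomp.
have -> : E l (g - pr dot (W_ l) g) = E l g - E l (pr dot (W_ l) g).
  exact: (bounded_opB _ _ (E_bounded lAb Abl)).
by rewrite (bounded_opB _ _ krein_M_bounded) !krein_M_E => /subr0_eq/oppr_inj.
Qed.

Lemma E_krein_M y : - E l (krein_M (E'adj l y)) = E l (prz (Rt y)).
Proof.
rewrite E'adjE// krein_M_pr krein_M_E.
have -> : E l (- prz (Rt y)) = - E l (prz (Rt y)).
  exact: (bounded_opN _ (E_bounded lAb Abl)).
by rewrite opprK.
Qed.

Lemma op_inv_T_ :
  op_inv (T_ l) = op_on (W_ l) (fun y => - E l (krein_M (E'adj l y))).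
Proof.
apply/seteqP; split=> -[y z]; rewrite /op_inv /op_on /= E_krein_M.
  move=> /(T_E Abl)[u [f [Auf -> ->]]]; split.
    by apply: pr_in => //; [exact: clW_|exact: sW_].
  rewrite prz_resolvent_pr; congr (E l (prz _)); apply/esym.
  by apply: resolvent_eq => //; rewrite subrK.
move=> [Wy ->]; apply/(T_E Abl); exists (Rt y), (y + l *: Rt y); split=> //.
- exact: resolventP.
- by rewrite addrK pr_id//; exact: sW_.
Qed.

(** The correction term is [E l (prz u)] at [u = Rt f], which [E_przE] evaluates as the difference
    of the two resolvents. *)
Lemma krein_resolvent f : resolvent At l f =
  resolvent Ab l f - E l (krein_M (E'adj l (pr dot (W_ l) f))).
Proof.
rewrite E_krein_M prz_resolvent_pr (E_przE Abl (resolventP f Atl)) addrK.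
by rewrite addrC subrK.
Qed.

End BothRegular.
End RegularTilde.

(** * Holomorphy of [M] in operator norm *)

Section Holomorphy.
Variable l0 : R[i].
Hypothesis Atl0 : resolvent_set At l0.
Let R0 := resolvent At l0.
(** The product rule applied to [S F - F R F], where [F] has derivative [- S] and [R] has derivative
    [R R]. [Q] is the exact second-order remainder, still containing the resolvent at [l]. *)
Let D u := - S (S u) - (F l0 (R0 (R0 (F l0 u))) - S (R0 (F l0 u)) - F l0 (R0 (S u))).
Let Q l u := F l0 (resolvent At l (R0 (R0 (F l0 u))))
  - S (resolvent At l (R0 (F l0 u))) - F l0 (resolvent At l (R0 (S u)))
  + S (resolvent At l (S u)).
Let bR0 : bounded_op R0. Proof. exact: resolvent_bounded. Qed.

(** Substitute [F l = F l0 - m S] and expand the resolvent at [l] around [R0] twice, once or not at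
    all, according to how many factors [m] the term already carries. *)
Lemma krein_M_taylor l u : resolvent_set At l ->
  krein_M l u - krein_M l0 u = (l - l0) *: D u - (l - l0) ^+ 2 *: Q l u.
Proof.
move=> Atl; have bR := resolvent_bounded lAt Atl; set m := l - l0.
have FE w : F l w = F l0 w - m *: S w by rewrite /F /m; vec.
have RE w : resolvent At l w = R0 w + m *: resolvent At l (R0 w).
  by rewrite /R0 /m -resolvent_identity// addrC subrK.
rewrite /krein_M -/R0 !FE (bounded_opB _ _ bR) (bounded_opZ _ _ bR).
rewrite !(bounded_opB _ _ bS) !(bounded_opB _ _ (bF l0)).
rewrite !(bounded_opZ _ _ bS) !(bounded_opZ _ _ (bF l0)).
have -> : F l0 (resolvent At l (F l0 u)) = F l0 (R0 (F l0 u)) +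
    m *: (F l0 (R0 (R0 (F l0 u))) + m *: F l0 (resolvent At l (R0 (R0 (F l0 u))))).
  rewrite RE (RE (R0 _)) (bounded_opD _ _ (bF l0)) (bounded_opZ _ _ (bF l0)).
  by rewrite (bounded_opD _ _ (bF l0)) (bounded_opZ _ _ (bF l0)).
have -> : F l0 (resolvent At l (S u)) =
    F l0 (R0 (S u)) + m *: F l0 (resolvent At l (R0 (S u))).
  by rewrite RE (bounded_opD _ _ (bF l0)) (bounded_opZ _ _ (bF l0)).
have -> : S (resolvent At l (F l0 u)) =
    S (R0 (F l0 u)) + m *: S (resolvent At l (R0 (F l0 u))).
  by rewrite RE (bounded_opD _ _ bS) (bounded_opZ _ _ bS).
rewrite /D /Q.
move: (F l0 (R0 (R0 (F l0 u)))) (F l0 (resolvent At l (R0 (R0 (F l0 u))))).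
move: (F l0 (resolvent At l (R0 (S u)))) (S (resolvent At l (R0 (F l0 u)))).
move: (S (R0 (F l0 u))) (S (resolvent At l (S u))) (F l0 (R0 (S u))) (S (S u)).
move: (F l0 (R0 (F l0 u))) (S (F l0 u)) => *; vec.
Qed.

Lemma krein_M_derivative_bounded : bounded_op D.
Proof.
have bSS := bounded_op_comp bS bS.
have bRF := bounded_op_comp bR0 (bF l0).
have b1 := bounded_op_comp (bF l0) (bounded_op_comp bR0 bRF).
have b2 := bounded_op_comp bS bRF.
have b3 := bounded_op_comp (bF l0) (bounded_op_comp bR0 bS).
have b4 := bounded_op_sub (bounded_op_sub b1 b2) b3.
have := bounded_op_sub (bounded_op_scale (-1) bSS) b4.
by congr (bounded_op _); apply/funext => u; rewrite scaleN1r.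
Qed.

Lemma krein_M_remainder_bound : exists c d : R[i], [/\ 0 < c, 0 < d &
  forall l, `|l - l0| < d -> resolvent_set At l /\ forall u, `|Q l u| <= c * `|u|].
Proof.
have [r [d [r0 d0 rP]]] : exists r d : R[i], [/\ 0 < r, 0 < d &
    forall m, `|m - l0| < d -> resolvent_set At m /\
      forall f, `|resolvent At m f| <= r * `|f|].
  by case: At_cdd => lA clA _; exact: resolvent_set_near.
have [s s0 sP] := bounded_op_bound bS; have [f f0 fP] := bounded_op_bound (bF l0).
have [q q0 qP] := bounded_op_bound bR0.
have chain (X : H -> H) (a b : R[i]) (y u : H) : 0 < a ->
    (forall x, `|X x| <= a * `|x|) -> `|y| <= b * `|u| -> `|X y| <= a * b * `|u|.
  move=> a0 XP yu; apply: le_trans (XP y) _.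
  by rewrite -mulrA ler_wpM2l// ltW.
(* One summand per term of [Q]; [f], [r], [q], [s] bound [F l0], the resolvents near [l0], [R0] and
   [S]. *)
exists (f * (r * (q * (q * f))) + s * (r * (q * f)) + f * (r * (q * s))
  + s * (r * s)), d.
split=> [|//|l /rP[Atl RP]]; first by rewrite !addr_gt0// !mulr_gt0.
split=> // u; rewrite /Q !mulrDl.
apply: le_trans (ler_normD _ _) _; apply: lerD; last by do 2!apply: (@chain) => //.
apply: le_trans (ler_normB _ _) _; apply: lerD; last by do 3!apply: (@chain) => //.
apply: le_trans (ler_normB _ _) _; apply: lerD; last by do 3!apply: (@chain) => //.
by do 4!apply: (@chain _ _ _ _ _) => //.
Qed.

Lemma krein_M_differentiable (eps : R[i]) : 0 < eps -> exists2 d : R[i], 0 < d &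
  forall l, l != l0 -> `|l - l0| < d -> resolvent_set At l /\ forall u,
  `|(l - l0)^-1 *: (krein_M l u - krein_M l0 u) - D u| <= eps * `|u|.
Proof.
move=> eps0; have [c [d [c0 d0 QP]]] := krein_M_remainder_bound.
have s0 : 0 < d^-1 + c / eps by rewrite addr_gt0 ?invr_gt0 ?divr_gt0.
(* This radius is below both [d] and [eps / c], without taking a minimum in the partially ordered
   [R[i]]. *)
exists (d^-1 + c / eps)^-1 => [|l ll0 ld]; first by rewrite invr_gt0.
have [|Atl {}QP] := QP l.
  by apply: lt_trans ld _; rewrite invf_plt ?posrE// ltrDl divr_gt0.
split=> // u; have m0 : l - l0 != 0 by rewrite subr_eq0.
have -> : (l - l0)^-1 *: (krein_M l u - krein_M l0 u) - D u = - ((l - l0) *: Q l u).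
  rewrite krein_M_taylor// scalerBr !scalerA mulVf// expr2 mulrA mulVf// mul1r.
  by rewrite scale1r addrAC subrr add0r.
rewrite normrN normrZ; apply: le_trans (ler_wpM2l (normr_ge0 _) (QP u)) _.
rewrite mulrA ler_wpM2r// -ler_pdivlMr// ltW//; apply: lt_trans ld _.
by rewrite invf_plt ?posrE ?divr_gt0// invf_div ltrDr invr_gt0.
Qed.

(** The formula for [D] does not show its range; but [D u] is a limit of difference quotients, which
    lie in the closed subspace [V]. *)
Lemma krein_M_derivative_V u : V (D u).
Proof.
apply: (@closed_dist R[i] H V); first exact: closed_closure.
move=> e e0; have u0 : 0 < `|u| + 1 by rewrite ltr_wpDl.
have [d d0 dP] := krein_M_differentiable (divr_gt0 e0 u0).
have tE : l0 + d / 2 - l0 = d / 2 by rewrite addrC addKr.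
have t0 : 0 < d / 2 by rewrite divr_gt0.
have [||Atl lP] := dP (l0 + d / 2).
- by rewrite -subr_eq0 tE gt_eqF.
- by rewrite tE gtr0_norm// ltr_pdivrMr// ltr_pMr// ltr1n.
exists ((l0 + d / 2 - l0)^-1 *: (krein_M (l0 + d / 2) u - krein_M l0 u)).
  by apply: (subspaceZ _ sV); apply: (subspaceB sV); exact: krein_M_V.
rewrite distrC; apply: le_lt_trans (lP u) _.
by rewrite mulrAC ltr_pdivrMr// ltr_pM2l// ltrDl.
Qed.

End Holomorphy.

Lemma bounded_operator_sub U1 U2 X : bounded_op X -> (forall u, U2 (X u)) ->
  bounded_operator U1 U2 X.
Proof.
move=> bX XV; split=> //; first by case: bX => _ lX _ a u v _ _; exact: lX.
by have [c _ cP] := bounded_op_bound bX; exists c => u _; exact: cP.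
Qed.

Lemma krein_M_holomorphic :
  holomorphic_family (resolvent_set At) W V krein_M.
Proof.
split.
  rewrite openE => l Atl; apply/nbhs_ballP.
  have [c [d [_ d0 dP]]] := krein_M_remainder_bound Atl.
  by exists d => // m; rewrite -ball_normE /= distrC => /dP[].
move=> l0 Atl0; eexists.
  apply: bounded_operator_sub (krein_M_derivative_bounded Atl0) _.
  exact: krein_M_derivative_V.
move=> eps eps0; have [d d0 dP] := krein_M_differentiable Atl0 eps0.
by apply: (near_dnbhs d0) => l ll0 ld u _; exact: (dP l ll0 ld).2.
Qed.

End Krein.

Theorem theorem2p13 (R : realType) (H : completeNormedModType R[i])
    (dot : {dot H for Num.conj}) (dot_norm : forall x : H, dot x x = `|x| ^+ 2)
    (Amin Amin' Ab At : set (H * H))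
    (Amin_cdd : closed_densely_defined Amin)
    (Amin'_cdd : closed_densely_defined Amin')
    (Amin_Amax : Amin `<=` adjoint dot Amin')
    (Amin'_Amax' : Amin' `<=` adjoint dot Amin)
    (Ab_cdd : closed_densely_defined Ab)
    (Amin_Ab : Amin `<=` Ab) (Ab_Amax : Ab `<=` adjoint dot Amin')
    (Ab0 : resolvent_set Ab 0)
    (At_cdd : closed_densely_defined At)
    (Amin_At : Amin `<=` At) (At_Amax : At `<=` adjoint dot Amin') :
  let Amax := adjoint dot Amin' in
  let Amax' := adjoint dot Amin in
  let Ab' := adjoint dot Ab in
  let At' := adjoint dot At in
  let Z' := ker Amax' in
  let Z_ l := ker (op_shift Amax l) in
  let prz := pr_along Ab Amax in
  let prz' := pr_along Ab' Amax' in
  let V := closure (prz @` dom At) in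
  let W := closure (prz' @` dom At') in
  let T := corresp_op dot prz Amax At W in
  let prz_ l := pr_along (op_shift Ab l) (op_shift Amax l) in
  let prz'_ l := pr_along (op_shift Ab' l^*) (op_shift Amax' l^*) in
  let W_ l := closure (prz'_ l @` dom At') in
  let T_ l := corresp_op dot (prz_ l) (op_shift Amax l) At (W_ l) in
  let E l u := u + l *: resolvent Ab l u in
  let E' l u := u + l^* *: resolvent Ab' l^* u in
  let F' l u := u - l^* *: app (op_inv Ab') u in
  let E'adj l := adjoint_on dot W (E' l) in
  let F'adj l := adjoint_on dot (W_ l) (F' l) in
  let G l z := - (l *: pr dot Z' (E l z)) in
  let TG l := op_add T (fun z => pr dot W (G l z)) in
  (exists M : R[i] -> H -> H,
    [/\ forall l, resolvent_set At l -> bounded_operator W V (M l),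
        holomorphic_family (resolvent_set At) W V M,
        forall l, resolvent_set At l -> resolvent_set Ab l ->
          op_inv (TG l) = op_on W (fun w => - M l w) /\
          op_inv (T_ l) = op_on (W_ l) (fun y => - E l (M l (E'adj l y))),
        forall l, resolvent_set At l -> forall z, Z_ l z -> dom T (prz z) ->
          M l (pr dot W (app Amax z) - app T (prz z)) = prz z &
        (forall l, resolvent_set At l -> forall w, W w ->
          let u := app (op_inv Ab) w in
          M l w = prz (u - resolvent At l (app (op_shift Amax l) u))) /\
        (forall l, resolvent_set At l -> resolvent_set Ab l -> forall f,
          resolvent At l f =
          resolvent Ab l f - E l (M l (E'adj l (pr dot (W_ l) f))))])
  /\ (forall l, resolvent_set Ab l ->
       ker (op_shift At l) = E l @` ker (TG l) /\
       ran (op_shift At l) =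
         [set y + h | y in F'adj l @` ran (TG l) &
                      h in orthocomp dot (W_ l)]).
Proof.
move=> Amax Amax' Ab' At' Z' Z_ prz prz' V W T prz_ prz'_ W_ T_ E E' F' E'adj F'adj.
move=> G TG.
split; last first.
  by move=> l Abl; split; [exact: ker_shift_TG|exact: ran_shift_TG].
exists (krein_M Ab At); split; last split.
- move=> l Atl; apply: bounded_operator_sub => [|w].
    exact: krein_M_bounded.
  exact: (krein_M_V dot_norm).
- exact: (krein_M_holomorphic dot_norm).
- by move=> l Atl Abl; split; [exact: op_inv_TG|exact: op_inv_T_].
- by move=> l Atl z; exact: krein_M_eigen.
- by move=> l Atl w _ u; rewrite /u app_op_inv; exact: krein_M_formula.
- by move=> l Atl Abl f; exact: (krein_resolvent dot_norm Amin_cdd Amin'_cdd).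
Qed.
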